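(* Let $X$ be an infinite-dimensional complex Banach space and let $T\in\mathcal{B}(X)$ be a bounded operator with adjoint $T^*\in\mathcal{B}(X^* )$. Then for any $\varepsilon>0$ there exists a finite rank operator $F\in\mathcal{B}(X)$ with $\lVert F\rVert<\varepsilon$ such that $T+F$ has an invariant half-space, i.e. there is a half-space $Y$ of $X$ with $(T+F)Y\subseteq Y$. Moreover, if $\partial\sigma(T)\setminus\sigma_p(T)\neq\emptyset$ or $\partial\sigma(T^{*})\setminus\sigma_p(T^{*})\neq\emptyset$, then (for every $\varepsilon>0$) $F$ can be taken to be of rank one.
   Context: $\mathcal{B}(X)$ denotes the algebra of all bounded linear operators on $X$. $X^*$ is the (continuous) dual of $X$ and $T^*: X^*\to X^*$ is the Banach space adjoint of $T$, $(T^*f)(x)=f(Tx)$. For an operator $S$, $\sigma(S)$ is its spectrum, $\partial\sigma(S)$ the topological boundary of $\sigma(S)$ in $\mathbb{C}$, and $\sigma_p(S)$ its point spectrum (the set of eigenvalues). A half-space of $X$ is a norm-closed linear subspace of $X$ of infinite dimension and infinite codimension. *)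

(* Defs.v *)
From HB Require Import structures.
From mathcomp Require Import all_boot all_order all_algebra complex.
From mathcomp Require Import boolp classical_sets functions reals topology.
From mathcomp Require Import normedtype.

Set Implicit Arguments.
Unset Strict Implicit.
Unset Printing Implicit Defensive.
Import Order.TTheory GRing.Theory Num.Theory.
Import numFieldNormedType.Exports.
Local Open Scope classical_set_scope.
Local Open Scope complex_scope.
Local Open Scope ring_scope.

(** ** Bounded linear operators between complex normed spaces *)

Section BoundedOperators.
Context {R : realType}.
Implicit Types U V W : normedModType R[i].

Definition bounded_operator V W (f : V -> W) : Prop :=
  exists M : R, forall x, `|f x| <= M%:C * `|x|.

Record bop V W := Bop {
  bop_fun :> {linear V -> W};
  bop_bounded : bounded_operator bop_fun }.

HB.instance Definition _ V W := gen_eqMixin (bop V W).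
HB.instance Definition _ V W := gen_choiceMixin (bop V W).

Lemma bopP V W (f g : bop V W) : (forall x, f x = g x) -> f = g.
Proof.
case: f g => [[f [[fD] [fZ]]] fb] [[g [[gD] [gZ]]] gb] /= fg.
have e : f = g by apply/funext.
subst g.
have <- : fD = gD by exact: Prop_irrelevance.
have <- : fZ = gZ by exact: Prop_irrelevance.
by have <- : fb = gb by exact: Prop_irrelevance.
Qed.

(** The modulus of the library is valued in [R[i]], with real values. *)
Lemma normRe V (x : V) : (complex.Re `|x|)%:C = `|x|.
Proof. by rewrite RRe_real// ger0_real. Qed.

Lemma bounded_operatorP V W (f : {linear V -> W}) :
  bounded_operator f <-> continuous f.
Proof.
rewrite -linear_bounded_continuous linear_boundedP; split=> [[M fM]|].
  exists M%:C; split; first by rewrite complex_real.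
  by move=> r /ltW Mr x; rewrite (le_trans (fM x))// ler_wpM2r.
move=> /pinfty_ex_gt0[r r0 fr]; exists (complex.Re r) => x.
by rewrite RRe_real ?fr// gtr0_real.
Qed.

Lemma bounded0 V W : bounded_operator (\0 : V -> W).
Proof. by exists 0 => x; rewrite /= normr0 mul0r. Qed.

Lemma boundedN V W (f : bop V W) : bounded_operator (\- f).
Proof. by have [M fM] := bop_bounded f; exists M => x /=; rewrite normrN. Qed.

Lemma boundedD V W (f g : bop V W) : bounded_operator (f \+ g).
Proof.
have [M fM] := bop_bounded f; have [N gN] := bop_bounded g.
exists (M + N) => x /=.
by rewrite rmorphD mulrDl (le_trans (ler_normD _ _))// lerD.
Qed.

Lemma boundedZ V W (a : R[i]) (f : bop V W) : bounded_operator (a \*: f).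
Proof.
have [M fM] := bop_bounded f.
exists (complex.Re `|a| * M) => x /=.
by rewrite rmorphM/= (normRe (a : R[i]^o)) normrZ -mulrA ler_wpM2l.
Qed.

Lemma bounded_id V : bounded_operator (@idfun V).
Proof. by exists 1 => x; rewrite mul1r. Qed.

Lemma bounded_comp U V W (g : bop V W) (f : bop U V) :
  bounded_operator (g \o f).
Proof.
have [M fM] := bop_bounded f; have [N gN] := bop_bounded g.
exists (Num.max 0 N * M) => x /=; rewrite (le_trans (gN _))//.
rewrite rmorphM -mulrA (@le_trans _ _ ((Num.max 0 N)%:C * `|f x|))//.
  by rewrite ler_wpM2r// lecR le_max lexx orbT.
by rewrite ler_wpM2l// lecR le_max lexx.
Qed.

Definition bop0 V W : bop V W := Bop (@bounded0 V W).
Definition bopN V W (f : bop V W) : bop V W := Bop (boundedN f).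
Definition bopD V W (f g : bop V W) : bop V W := Bop (boundedD f g).
Definition bopZ V W (a : R[i]) (f : bop V W) : bop V W := Bop (boundedZ a f).
Definition bop_id V : bop V V := Bop (@bounded_id V).
Definition bop_comp U V W (g : bop V W) (f : bop U V) : bop U W :=
  Bop (bounded_comp g f).

Section Instances.
Context {V W : normedModType R[i]}.
Implicit Types f g h : bop V W.

Lemma bopDA : associative (@bopD V W).
Proof. by move=> f g h; apply: bopP => x /=; rewrite addrA. Qed.
Lemma bopDC : commutative (@bopD V W).
Proof. by move=> f g; apply: bopP => x /=; rewrite addrC. Qed.
Lemma bop0D : left_id (@bop0 V W) (@bopD V W).
Proof. by move=> f; apply: bopP => x /=; rewrite add0r. Qed.
Lemma bopND : left_inverse (@bop0 V W) (@bopN V W) (@bopD V W).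
Proof. by move=> f; apply: bopP => x /=; rewrite addNr. Qed.

HB.instance Definition _ :=
  GRing.isZmodule.Build (bop V W) bopDA bopDC bop0D bopND.

Lemma bopZA (a b : R[i]) f : bopZ a (bopZ b f) = bopZ (a * b) f.
Proof. by apply: bopP => x /=; rewrite scalerA. Qed.
Lemma bop1Z : left_id 1 (@bopZ V W).
Proof. by move=> f; apply: bopP => x /=; rewrite scale1r. Qed.
Lemma bopZDr : right_distributive (@bopZ V W) +%R.
Proof. by move=> a f g; apply: bopP => x /=; rewrite scalerDr. Qed.
Lemma bopZDl f : {morph (@bopZ V W)^~ f : a b / a + b}.
Proof. by move=> a b; apply: bopP => x /=; rewrite scalerDl. Qed.

HB.instance Definition _ :=
  GRing.Zmodule_isLmodule.Build R[i] (bop V W) bopZA bop1Z bopZDr bopZDl.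

Lemma bopDE f g x : (f + g) x = f x + g x. Proof. by []. Qed.
Lemma bopNE f x : (- f) x = - f x. Proof. by []. Qed.
Lemma bopZE a f x : (a *: f) x = a *: f x. Proof. by []. Qed.

Definition opnorm f : R :=
  sup [set complex.Re `|f x| | x in [set x | `|x| <= 1]].

Lemma opnorm_ub f x : `|x| <= 1 -> `|f x| <= (opnorm f)%:C.
Proof.
move=> x1; rewrite -normRe lecR; apply: ub_le_sup; last by exists x.
have [M fM] := bop_bounded f; exists (Num.max 0 M) => _ [y /= y1 <-].
rewrite -lecR normRe (le_trans (fM y))//.
rewrite (@le_trans _ _ ((Num.max 0 M)%:C * `|y|))//.
  by rewrite ler_wpM2r// lecR le_max lexx orbT.
by rewrite ler_piMr// lecR le_max lexx.
Qed.

Lemma opnorm_le f (M : R) :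
  (forall x, `|x| <= 1 -> `|f x| <= M%:C) -> opnorm f <= M.
Proof.
move=> fM; apply: ge_sup.
  by exists (complex.Re `|f 0|), 0 => //=; rewrite normr0.
by move=> _ [x /= x1 <-]; rewrite -lecR normRe fM.
Qed.

Lemma opnorm_ge0 f : 0 <= opnorm f.
Proof.
by rewrite -lecR (le_trans _ (@opnorm_ub f 0 _)) ?normr0// ?normr_ge0.
Qed.

Lemma opnormP f x : `|f x| <= (opnorm f)%:C * `|x|.
Proof.
have [->|x0] := eqVneq x 0; first by rewrite linear0 !normr0 mulr0.
rewrite -ler_pdivrMr ?normr_gt0//.
have := @opnorm_ub f (`|x|^-1 *: x).
rewrite linearZ/= !normrZ normfV normr_id mulVf ?normr_eq0//.
by rewrite mulrC; apply.
Qed.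

Let norm f : R[i] := (opnorm f)%:C.

Lemma opnormD f g : norm (f + g) <= norm f + norm g.
Proof.
rewrite /norm -rmorphD lecR; apply: opnorm_le => x x1.
by rewrite bopDE rmorphD (le_trans (ler_normD _ _))// lerD// opnorm_ub.
Qed.

Lemma opnormZ a f : norm (a *: f) = `|a| * norm f.
Proof.
have le b h : norm (b *: h) <= `|b| * norm h.
  rewrite /norm -(normRe (b : R[i]^o)) -rmorphM lecR; apply: opnorm_le => x x1.
  by rewrite bopZE normrZ rmorphM/= (normRe (b : R[i]^o)) ler_wpM2l// opnorm_ub.
have [->|a0] := eqVneq a 0.
  apply/eqP; rewrite eq_le le/= normr0 mul0r lecR; exact: opnorm_ge0.
apply/eqP; rewrite eq_le le/= -ler_pdivlMl ?normr_gt0// -normfV.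
by rewrite -{1}(scale1r f) -(mulVf a0) -scalerA le.
Qed.

Lemma opnorm0_eq0 f : norm f = 0 -> f = 0.
Proof.
move=> f0; apply: bopP => x; apply/eqP.
rewrite -normr_le0 (le_trans (opnormP f x))//.
by rewrite [X in X * _]f0 mul0r.
Qed.

HB.instance Definition _ :=
  Lmodule_isNormed.Build R[i] (bop V W) opnormD opnormZ opnorm0_eq0.

Lemma bop_normE f : `|f| = (opnorm f)%:C.
Proof. by []. Qed.

End Instances.
End BoundedOperators.

(** ** Spectrum *)

Section Spectrum.
Context {R : realType} {V : normedModType R[i]}.
Implicit Types S : bop V V.

Definition invertible S : Prop :=
  exists S' : bop V V, bop_comp S' S = bop_id V /\ bop_comp S S' = bop_id V.

(** [R[i]^o] is [R[i]], carrying its usual topology. *)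
Definition spectrum S : set R[i]^o :=
  [set lambda | ~ invertible (S - lambda *: bop_id V)].

Definition point_spectrum S : set R[i]^o :=
  [set lambda | exists2 x : V, x != 0 & S x = lambda *: x].

End Spectrum.

Definition boundary {T : topologicalType} (A : set T) : set T :=
  closure A `\` interior A.

(** ** Continuous dual and adjoint *)

Section Dual.
Context {R : realType} {X : normedModType R[i]}.

Definition dual := bop X R[i]^o.
HB.instance Definition _ := NormedModule.on dual.

Variable T : bop X X.

Definition adjoint_fun (f : dual) : dual := bop_comp f T.

Lemma adjoint_linear : linear adjoint_fun.
Proof. by move=> a f g; apply: bopP. Qed.

HB.instance Definition _ :=
  GRing.isLinear.Build R[i] dual dual _ adjoint_fun adjoint_linear.

Lemma adjoint_bounded : bounded_operator adjoint_fun.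
Proof.
exists (opnorm T) => f; rewrite !bop_normE -rmorphM lecR.
apply: opnorm_le => x x1 /=; rewrite (le_trans (opnormP _ _))//.
rewrite mulrC rmorphM ler_wpM2r ?lecR ?opnorm_ge0//.
exact: opnorm_ub.
Qed.

Definition adjoint : bop dual dual := Bop adjoint_bounded.

End Dual.
Arguments dual {R} X.

(** ** Dimension, codimension, rank *)

Section Dimension.
Context {K : fieldType} {V : lmodType K}.
Implicit Types Y : set V.

Definition lincomb n (v : 'I_n -> V) (c : 'I_n -> K) : V :=
  \sum_(i < n) c i *: v i.

Definition subspace Y : Prop :=
  Y 0 /\ forall (a : K) x y, Y x -> Y y -> Y (a *: x + y).

Definition has_dim n Y : Prop :=
  exists v : 'I_n -> V,
    (forall c, lincomb v c = 0 -> forall i, c i = 0) /\ Y = range (lincomb v).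

(** The classes of the [v i] form a basis of the quotient of [V] by [Y]. *)
Definition has_codim n Y : Prop :=
  exists v : 'I_n -> V,
    (forall c, Y (lincomb v c) -> forall i, c i = 0) /\
    (forall x, exists c, Y (x - lincomb v c)).

Definition finite_dim Y : Prop := exists n, has_dim n Y.
Definition finite_codim Y : Prop := exists n, has_codim n Y.

End Dimension.

Section Operators.
Context {R : realType} {X : normedModType R[i]}.

Definition has_rank n (F : bop X X) : Prop := has_dim n (range F).
Definition finite_rank (F : bop X X) : Prop := exists n, has_rank n F.

Definition half_space (Y : set X) : Prop :=
  [/\ subspace Y, closed Y, ~ finite_dim Y & ~ finite_codim Y].

Definition has_invariant_half_space (S : bop X X) : Prop :=
  exists2 Y : set X, half_space Y & S @` Y `<=` Y.

End Operators.

(* Main.v *)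
(** If regular points [lam n] tend to a spectral point [mu], the resolvents blow
    up, and so does some orbit [h n = (T - lam n)^-1 e]. The unit vectors
    [x n = h n / |h n|] satisfy [T x n = lam n x n + e / |h n|] and are approximate
    eigenvectors. Unless [mu] is an eigenvalue they have no norm-convergent
    subsequence; subtracting their weak* limit along a free ultrafilter, one
    extracts a subsequence with biorthogonal functionals and a functional [z] of
    small norm with [z (x n) = - 1 / |h n|]. Then the [x n] are eigenvectors of
    [T + z (.) e], and every other one of them generates an invariant half-space.
    The same argument in the dual, with functionals [x n] and vectors [z] of [X],
    handles the adjoint.

    For an arbitrary [T] take a boundary point [mu] of the spectrum. Infinite
    dimensional kernels of [T - mu] or of its adjoint give half-spaces at once;
    otherwise a small finite rank perturbation makes [T - mu] or its adjoint
    injective. Either [mu] is still in the spectrum and the first part applies, or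
    [T - mu] is an invertible operator plus one of finite rank. If this last case
    occurs at all boundary points and they are infinitely many, their eigenvectors
    and those of the adjoint give a half-space. If they are finitely many, they
    are the whole spectrum, and the product of the [T - mu] is quasinilpotent but
    also invertible up to finite rank, which is impossible in infinite
    dimension. *)

From HB Require Import structures.
Require Import Defs.
From mathcomp Require Import all_boot all_order all_algebra complex.
From mathcomp Require Import boolp classical_sets functions reals topology.
From mathcomp Require Import normedtype sequences ring lra.

Set Implicit Arguments.
Unset Strict Implicit.
Unset Printing Implicit Defensive.
Import Order.TTheory GRing.Theory Num.Theory.
Import numFieldNormedType.Exports.
Local Open Scope classical_set_scope.
Local Open Scope complex_scope.
Local Open Scope ring_scope.

(** * Real-valued norms *)

(** The unit ball of X need not be weakly compact, so the limit [psi] of the normalised orbit is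
    only a functional on the paired space, in general not given by a vector. Hence the construction
    runs in an abstract pairing of [B] and [W], used once as X with its dual and once as the dual
    with X, where the norm of [B] is recovered from the unit ball of [W]. For general T the kernels
    of T - mu and of its adjoint may have different dimensions; the smaller one decides whether T or
    its adjoint is made injective. The perturbation must also keep mu a limit of regular points. At
    a regular point of T only finitely many multiples of a finite rank operator are harmful, their
    number being bounded independently of the point, so some small multiple is good at points
    arbitrarily close to mu. Quasinilpotence enters as convergence to 0 of the powers of exponent
    2^k of every multiple of the operator. It is derived from averages of resolvents over roots of
    unity, with no contour integral. *)

Section RealNorm.
Context {R : realType} {V : normedZmodType R[i]}.
Implicit Types x y : V.

(** The norm takes values in [R[i]], whose order is only partial; a real copy opens the estimates to
    [lra] and [nra]. *)
Definition nrm x : R := complex.Re `|x|.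

Lemma nrmE x : (nrm x)%:C = `|x|.
Proof. by rewrite RRe_real// ger0_real. Qed.

Lemma nrm_le x (M : R) : (nrm x <= M) = (`|x| <= M%:C).
Proof. by rewrite -nrmE lecR. Qed.

Lemma nrm_ge0 x : 0 <= nrm x.
Proof. by rewrite -lecR nrmE normr_ge0. Qed.

Lemma nrm0 : nrm 0 = 0.
Proof. by rewrite /nrm normr0. Qed.

Lemma nrm0_eq0 x : nrm x = 0 -> x = 0.
Proof. by move=> x0; apply/eqP; rewrite -normr_eq0 -nrmE x0. Qed.

Lemma nrm_gt0 x : (0 < nrm x) = (x != 0).
Proof.
rewrite lt_neqAle nrm_ge0 andbT eq_sym; congr negb; apply/eqP/eqP => [|->].
  exact: nrm0_eq0.
exact: nrm0.
Qed.

Lemma nrmN x : nrm (- x) = nrm x.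
Proof. by rewrite /nrm normrN. Qed.

Lemma nrmD x y : nrm (x + y) <= nrm x + nrm y.
Proof. by rewrite nrm_le rmorphD/= !nrmE ler_normD. Qed.

Lemma nrmB x y : nrm (x - y) <= nrm x + nrm y.
Proof. by rewrite (le_trans (nrmD _ _))// nrmN. Qed.

Lemma nrm_sub x y : nrm (x - y) = nrm (y - x).
Proof. by rewrite -nrmN opprB. Qed.

Lemma nrm_tri x y z : nrm (x - z) <= nrm (x - y) + nrm (y - z).
Proof. by rewrite (le_trans _ (nrmD _ _))// addrA subrK. Qed.

Lemma nrm_rev x y : nrm x - nrm y <= nrm (x - y).
Proof. by rewrite lerBlDr (le_trans _ (nrmD _ _))// subrK. Qed.

End RealNorm.

Section RealNormZ.
Context {R : realType}.

Lemma nrmZ {V : normedModType R[i]} (a : R[i]) (x : V) :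
  nrm (a *: x) = nrm a * nrm x.
Proof. by apply: complexI; rewrite rmorphM/= !nrmE normrZ. Qed.

Lemma nrmM (a b : R[i]) : nrm (a * b) = nrm a * nrm b.
Proof. by apply: complexI; rewrite rmorphM/= !nrmE normrM. Qed.

Lemma nrm1 : nrm (1 : R[i]) = 1.
Proof. by apply: complexI; rewrite nrmE normr1. Qed.

Lemma nrmV (a : R[i]) : nrm a^-1 = (nrm a)^-1.
Proof. by apply: complexI; rewrite fmorphV/= !nrmE normfV. Qed.

Lemma nrmC (r : R) : nrm r%:C = `|r|.
Proof. by apply: complexI; rewrite nrmE normc_def/= expr0n addr0 sqrtr_sqr. Qed.

Lemma nrm_Re (a : R[i]) : `|complex.Re a| <= nrm a.
Proof. by rewrite -lecR nrmE normc_ge_Re. Qed.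

Lemma nrm_Im (a : R[i]) : `|complex.Im a| <= nrm a.
Proof.
by case: a => x y; rewrite /nrm/= -(sqrtr_sqr y) ler_wsqrtr// lerDr sqr_ge0.
Qed.

Lemma nrm_ReIm (a : R[i]) : nrm a <= `|complex.Re a| + `|complex.Im a|.
Proof.
rewrite [a in nrm a]complexE (le_trans (nrmD _ _))// nrmM.
have -> : nrm ('i : R[i]) = 1.
  by apply: complexI; rewrite nrmE normc_def/= expr0n add0r expr1n sqrtr1.
by rewrite !nrmC mul1r.
Qed.

End RealNormZ.

(** * The ring of bounded operators *)

Section BopRing.
Context {R : realType} {V : normedModType R[i]}.
Implicit Types f g h : bop V V.

Lemma bopMA : associative (@bop_comp R V V V).
Proof. by move=> f g h; apply: bopP. Qed.
Lemma bop1M : left_id (bop_id V) (@bop_comp R V V V).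
Proof. by move=> f; apply: bopP. Qed.
Lemma bopM1 : right_id (bop_id V) (@bop_comp R V V V).
Proof. by move=> f; apply: bopP. Qed.
Lemma bopMDl : left_distributive (@bop_comp R V V V) +%R.
Proof. by move=> f g h; apply: bopP. Qed.
Lemma bopMDr : right_distributive (@bop_comp R V V V) +%R.
Proof. by move=> f g h; apply: bopP => x /=; rewrite linearD. Qed.

(** [PzRing] allows 1 = 0, which happens when [V] is trivial. *)
HB.instance Definition _ :=
  GRing.Zmodule_isPzRing.Build (bop V V) bopMA bop1M bopM1 bopMDl bopMDr.

Lemma bopZAl (a : R[i]) f g : a *: (f * g) = (a *: f) * g.
Proof. exact: bopP. Qed.
Lemma bopZAr (a : R[i]) f g : a *: (f * g) = f * (a *: g).
Proof. by apply: bopP => x /=; rewrite linearZ. Qed.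

Lemma bopME f g x : (f * g) x = f (g x). Proof. by []. Qed.
Lemma bop1E x : (1 : bop V V) x = x. Proof. by []. Qed.

End BopRing.
Section MakeBop.
Context {R : realType} {V W : normedModType R[i]}.

(** Operators obtained by choice or as pointwise limits start out as bare functions; this is their
    way into [bop]. *)
Lemma make_bop (f : V -> W) (M : R) :
  linear f -> (forall x, nrm (f x) <= M * nrm x) ->
  exists F : bop V W, forall x, F x = f x.
Proof.
move=> flin fM.
pose fl := GRing.isLinear.Build _ _ _ _ f flin.
pose F : {linear V -> W} := HB.pack f fl.
have bF : bounded_operator F.
  by exists M => x; rewrite -!nrmE -rmorphM lecR.
by exists (Bop bF).
Qed.

Lemma nrm_bop (f : bop V W) : nrm f = opnorm f.
Proof. by rewrite /nrm bop_normE. Qed.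

Lemma bop_le (f : bop V W) x : nrm (f x) <= nrm f * nrm x.
Proof. by rewrite nrm_bop -lecR rmorphM/= !nrmE opnormP. Qed.

Lemma bop_nrm_le (f : bop V W) (M : R) :
  0 <= M -> (forall x, nrm (f x) <= M * nrm x) -> nrm f <= M.
Proof.
move=> M0 fM; rewrite nrm_bop; apply: opnorm_le => x x1.
by rewrite -nrmE lecR (le_trans (fM x))// ler_piMr// nrm_le.
Qed.

Lemma bop_gt_nrm (f : bop V W) (M : R) :
  0 <= M -> M < nrm f -> exists x, x != 0 /\ M * nrm x < nrm (f x).
Proof.
move=> M0 Mf; apply: contrapT => h.
have : nrm f <= M.
  apply: bop_nrm_le => // x; have [->|x0] := eqVneq x 0.
    by rewrite linear0 !nrm0 mulr0.
  by rewrite leNgt; apply/negP => hx; apply: h; exists x.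
by rewrite leNgt Mf.
Qed.

End MakeBop.

Section BopNorm.
Context {R : realType} {V : normedModType R[i]}.

Lemma nrm_comp (f g : bop V V) : nrm (f * g) <= nrm f * nrm g.
Proof.
apply: bop_nrm_le => [|x]; first by rewrite mulr_ge0 ?nrm_ge0.
by rewrite -mulrA bopME (le_trans (bop_le _ _))// ler_wpM2l ?nrm_ge0 ?bop_le.
Qed.

Lemma nrm_one : nrm (1 : bop V V) <= 1.
Proof. by apply: bop_nrm_le => // x; rewrite bop1E mul1r. Qed.

End BopNorm.

(** * Norming functionals *)

Section NormingFunctional.
Context {R : realType} {V : normedModType R[i]}.
Implicit Types (p q : V -> R) (x y : V).

(** Homogeneity is asked only as an inequality; equality follows by rescaling with t^-1. The bound
    by the norm gives, with subadditivity, the lower bound - |x| that makes the later infima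
    finite. *)
Definition sublinear p : Prop :=
  [/\ forall x y, p (x + y) <= p x + p y,
      forall (t : R) x, 0 <= t -> p (t%:C *: x) <= t * p x
    & forall x, p x <= nrm x].

Lemma sublinear_nrm : sublinear (@nrm R V).
Proof.
split=> [x y|t x t0|//]; first exact: nrmD.
by rewrite nrmZ nrmC ger0_norm.
Qed.

Lemma sublinear0 p : sublinear p -> p 0 = 0.
Proof.
move=> [pD pZ _]; apply/eqP; rewrite eq_le.
have := pZ 0 0 (lexx _); rewrite scaler0 mul0r => ->/=.
by have := pD 0 0; rewrite addr0; lra.
Qed.

Lemma sublinear_lb p : sublinear p -> forall x, - nrm x <= p x.
Proof.
move=> sp x; have [pD _ pn] := sp; have := pD x (- x).
by rewrite subrr sublinear0// => h; have := pn (- x); rewrite nrmN; lra.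
Qed.

Lemma sublinear_scale p : sublinear p ->
  forall (t : R) x, 0 <= t -> p (t%:C *: x) = t * p x.
Proof.
move=> sp t x; have [_ pZ _] := sp.
rewrite le_eqVlt => /predU1P[<-|t0].
  by rewrite scale0r mul0r sublinear0.
apply/eqP; rewrite eq_le (pZ _ _ (ltW t0))/=.
have /(_ _) := pZ t^-1 (t%:C *: x); rewrite invr_ge0 ltW// => /(_ isT).
rewrite scalerA -rmorphM mulVf ?gt_eqF// scale1r.
by rewrite -(ler_pM2l t0) mulrA mulfV ?gt_eqF// mul1r.
Qed.

(* The largest sublinear functional below [p] whose value at [- y] is
   [- p y]: a minimal sublinear functional must coincide with it. *)
Definition lower_at p y x : R :=
  inf [set p (x + t%:C *: y) - t * p y | t in [set t | 0 <= t]].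

Lemma lower_at_lb p y x : sublinear p ->
  has_lbound [set p (x + t%:C *: y) - t * p y | t in [set t | 0 <= t]].
Proof.
move=> sp; have [pD _ pn] := sp; exists (- nrm x) => _ [t /= t0 <-].
have := pD (x + t%:C *: y) (- x); rewrite addrAC subrr add0r.
by rewrite sublinear_scale//; have := pn (- x); rewrite nrmN; lra.
Qed.

Lemma lower_at_le p y x (t : R) : sublinear p -> 0 <= t ->
  lower_at p y x <= p (x + t%:C *: y) - t * p y.
Proof.
by move=> sp t0; apply: ge_inf; [exact: lower_at_lb|exists t].
Qed.

Lemma le_lower_at p y x (M : R) :
  (forall t : R, 0 <= t -> M <= p (x + t%:C *: y) - t * p y) ->
  M <= lower_at p y x.
Proof.
move=> Mp; apply: lb_le_inf; last by move=> _ [t t0 <-]; exact: Mp.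
by exists (p (x + 0%:C *: y) - 0 * p y), 0 => /=.
Qed.

Lemma lower_at_lep p y x : sublinear p -> lower_at p y x <= p x.
Proof.
move=> sp; have := lower_at_le y x sp (lexx 0).
by rewrite scale0r addr0 mul0r subr0.
Qed.

Lemma lower_at_opp p y : sublinear p -> lower_at p y (- y) <= - p y.
Proof.
move=> sp; have := lower_at_le y (- y) sp ler01.
by rewrite scale1r addNr sublinear0// mul1r add0r.
Qed.

Lemma sublinear_lower_at p y : sublinear p -> sublinear (lower_at p y).
Proof.
move=> sp; have [pD pZ pn] := sp; split.
- move=> x z; rewrite -lerBlDr; apply: le_lower_at => t t0.
  rewrite lerBlDr -lerBlDl; apply: le_lower_at => s s0.
  have := lower_at_le y (x + z) sp (addr_ge0 t0 s0).
  have := pD (x + t%:C *: y) (z + s%:C *: y).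
  by rewrite addrACA -scalerDl -rmorphD/=; lra.
- move=> t x; rewrite le_eqVlt => /predU1P[<-|t0].
    rewrite scale0r mul0r; have := lower_at_lep y 0 sp.
    by rewrite (sublinear0 sp).
  rewrite mulrC -ler_pdivrMr//; apply: le_lower_at => s s0.
  rewrite ler_pdivrMr//.
  have := lower_at_le y (t%:C *: x) sp (mulr_ge0 (ltW t0) s0).
  rewrite rmorphM/= -scalerA -scalerDr => /le_trans; apply.
  by rewrite (sublinear_scale sp _ (ltW t0)) mulrBl mulrC [s * _ * t]mulrC mulrA.
- by move=> x; rewrite (le_trans (lower_at_lep _ _ sp)).
Qed.

(** Zorn's lemma for the reversed pointwise order. A chain is bounded by its pointwise infimum,
    which is subadditive because of any two members the smaller one serves for both arguments. *)
Lemma minimal_sublinear p : sublinear p ->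
  exists q, [/\ sublinear q, forall x, q x <= p x &
    forall q', sublinear q' -> (forall x, q' x <= q x) ->
      forall x, q x <= q' x].
Proof.
move=> sp; pose T := {q | sublinear q /\ forall x, q x <= p x}.
pose r (q q' : T) := `[< forall x, sval q' x <= sval q x >].
have p0 : T by exists p.
have [||A tA|[q [sq qp]] qmin] := @ZL_preorder T p0 r.
- by move=> q; apply/asboolP.
- move=> q1 q2 q3 /asboolP h1 /asboolP h2; apply/asboolP => x.
  exact: le_trans (h2 x) (h1 x).
- have [->|/set0P[a0 Aa0]] := eqVneq A set0.
    by exists p0.
  pose m x := inf [set sval a x | a in A].
  have mlb x : has_lbound [set sval a x | a in A].
    by exists (- nrm x) => _ [[a [sa ap]] _ <-]; exact: sublinear_lb.
  have mle a x : A a -> m x <= sval a x.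
    by move=> Aa; apply: ge_inf => //; exists a.
  have lem x (M : R) : (forall a, A a -> M <= sval a x) -> M <= m x.
    move=> h; apply: lb_le_inf; first by exists (sval a0 x), a0.
    by move=> _ [a Aa <-]; exact: h.
  have sm : sublinear m.
    split.
    + move=> x y; rewrite -lerBlDr; apply: (lem _ _) => a Aa.
      suff : m (x + y) - sval a x <= m y by lra.
      apply: (lem _ _) => b Ab.
      have [/asboolP ab|/asboolP ba] := tA _ _ Aa Ab.
        have [[bD _ _] _] := svalP b; have := bD x y.
        by have := mle _ (x + y) Ab; have := ab x; lra.
      have [[aD _ _] _] := svalP a; have := aD x y.
      by have := mle _ (x + y) Aa; have := ba y; lra.
    + move=> t x; rewrite le_eqVlt => /predU1P[<-|t0].
        rewrite scale0r mul0r; have [sa _] := svalP a0.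
        by rewrite -(sublinear0 sa); exact: mle.
      rewrite mulrC -ler_pdivrMr//; apply: (lem _ _) => a Aa.
      rewrite ler_pdivrMr// (le_trans (mle _ _ Aa))//.
      have [[_ aZ _] _] := svalP a.
      by rewrite mulrC aZ// ltW.
    + move=> x; rewrite (le_trans (mle _ _ Aa0))//.
      by have [[_ _ ->]] := svalP a0.
  have mp x : m x <= p x.
    by rewrite (le_trans (mle _ _ Aa0))//; have [_ ->] := svalP a0.
  exists (exist _ m (conj sm mp)) => a Aa; apply/asboolP => x /=.
  exact: mle.
exists q; split=> // q' sq' q'q x.
have q'p y : q' y <= p y by rewrite (le_trans (q'q y)).
have qq' : r (exist _ q (conj sq qp)) (exist _ q' (conj sq' q'p)).
  exact/asboolP.
by have /asboolP := qmin _ qq'.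
Qed.

(** A minimal g lies below [lower_at g y], which forces g (- y) = - g y, and an odd subadditive
    functional is additive. Starting below [lower_at] of the norm at x0 fixes the value at x0. *)
Lemma dominated_real_linear (x0 : V) :
  exists g : V -> R, [/\ forall x y, g (x + y) = g x + g y,
    forall (t : R) x, g (t%:C *: x) = t * g x,
    forall x, g x <= nrm x & g x0 = nrm x0].
Proof.
have sq := sublinear_lower_at x0 sublinear_nrm.
have [g [sg gq gmin]] := minimal_sublinear sq.
have gopp y : g (- y) = - g y.
  apply/eqP; rewrite eq_le; apply/andP; split.
    apply: le_trans (lower_at_opp y sg).
    apply: gmin; first exact: sublinear_lower_at.
    by move=> x; exact: lower_at_lep.
  have [gD _ _] := sg; have := gD y (- y).
  by rewrite subrr sublinear0//; lra.
have [gD gZ gn] := sg.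
have gA x y : g (x + y) = g x + g y.
  apply/eqP; rewrite eq_le gD/=.
  by have := gD (x + y) (- y); rewrite addrK gopp; lra.
exists g; split=> //.
  move=> t x; have [t0|t0] := leP 0 t; first exact: sublinear_scale.
  rewrite -[t]opprK rmorphN/= scaleNr gopp sublinear_scale ?mulNr//.
  by rewrite oppr_ge0 ltW.
apply/eqP; rewrite eq_le gn/=.
have := le_trans (gq (- x0)) (lower_at_opp x0 sublinear_nrm).
by rewrite gopp lerN2.
Qed.

Theorem norming_functional (x0 : V) :
  exists f : dual V, (forall x, nrm (f x) <= nrm x) /\ nrm (f x0) = nrm x0.
Proof.
have [g [gD gZ gn g0]] := dominated_real_linear x0.
have gN x : g (- x) = - g x by rewrite -scaleN1r -(rmorphN1 (real_complex R)) gZ mulN1r.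
(* The complex-linear functional with real part g. *)
pose f x : R[i]^o := (g x +i* - g ('i *: x))%C.
have flin : linear f.
  move=> [a b] x y; rewrite /f.
  have aE : (a +i* b)%C = a%:C + 'i * b%:C :> R[i] 
    by simpc.
  have h z : g ((a +i* b)%C *: z) = a * g z + b * g ('i *: z).
    by rewrite aE scalerDl gD gZ ['i * _]mulrC -scalerA gZ.
  rewrite gD h scalerDr gD scalerA ['i * (_ +i* _)%C]mulrC -scalerA h scalerA.
  rewrite (_ : 'i * 'i = -1) ?scaleN1r; last by rewrite -expr2 sqr_i.
  rewrite gN; apply/eqP; rewrite eq_complex/=; apply/andP; split.
    by apply/eqP; lra.
  by apply/eqP; lra.
have fn x : nrm (f x) <= nrm x.
  have [->|fx0] := eqVneq (f x) 0; first by rewrite nrm0 nrm_ge0.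
  (* The phase that makes f (u x) equal to |f x|, so that the real bound for g at u x applies. *)
  pose u : R[i] := `|f x| / f x.
  have u1 : nrm u = 1.
    by apply: complexI; rewrite nrmE normf_div normr_id mulfV ?normr_eq0.
  have fu : f (u *: x) = (nrm (f x))%:C.
    have -> : f (u *: x) = u * f x.
      have := flin u x 0; rewrite addr0 => ->.
      rewrite /f scaler0 -(scale0r 0) -(rmorph0 (real_complex R)) gZ mul0r.
      by rewrite oppr0 addr0.
    by rewrite nrmE /u mulfVK.
  have := gn (u *: x); rewrite nrmZ u1 mul1r => /(le_trans _); apply.
  by have /(congr1 (@complex.Re R)) /= := fu; move=> ->.
have [|F Ff] := make_bop (M := 1) flin; first by move=> x; rewrite mul1r.
exists F; rewrite !Ff; split=> [x|]; first by rewrite Ff.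
apply/eqP; rewrite eq_le fn/=.
by rewrite -[leLHS]g0 (le_trans (ler_norm _))// (nrm_Re (f x0)).
Qed.

End NormingFunctional.

(** * Ultralimits and completeness *)

Section RealSequences.
Context {R : realType}.

Lemma half_expr_gt0 n : 0 < (2^-1 : R) ^+ n.
Proof. by rewrite exprn_gt0// invr_gt0. Qed.

Lemma half_expr_le1 n : (2^-1 : R) ^+ n <= 1.
Proof. by apply: exprn_ile1; lra. Qed.

Lemma half_exprS n : (2^-1 : R) ^+ n.+1 = 2^-1 ^+ n / 2.
Proof. by rewrite exprS mulrC. Qed.

Lemma half_expr_small (e : R) : 0 < e ->
  exists N, forall n, (N <= n)%N -> 2^-1 ^+ n < e.
Proof.
move=> e0; have [N eN] : exists N : nat, e^-1 < N%:R.
  by exists (Num.truncn e^-1).+1; rewrite truncnS_gt.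
exists N => n Nn; rewrite exprVn -[ltRHS]invrK ltf_pV2 ?posrE ?exprn_gt0 ?invr_gt0//.
rewrite (lt_le_trans eN)// -natrX ler_nat (leq_trans Nn)//.
by rewrite ltnW// ltn_expl.
Qed.

End RealSequences.

Section FreeUltrafilter.
Context {R : realType}.

Lemma free_ultrafilter : exists U : set_system nat,
  UltraFilter U /\ forall N, U [set n | (N <= n)%N].
Proof.
have [U [UU ooU]] := ultraFilterLemma (F := \oo) _.
exists U; split=> // N; apply: ooU; exact: nbhs_infty_ge.
Qed.

Context (U : set_system nat) {UU : UltraFilter U}.

Lemma ultra_nonempty (A : set nat) : U A -> exists n, A n.
Proof. exact: filter_ex. Qed.

Lemma ultra_compl (A : set nat) : ~ U A -> U (~` A).
Proof. by have [] := in_ultra_setVsetC A UU. Qed.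

(** The limit is the supremum of the levels reached on a set in [U]; above it, the ultrafilter
    decides for the complement. *)
Lemma ultra_lim_real (x : nat -> R) (M : R) : (forall n, `|x n| <= M) ->
  exists l, forall e, 0 < e -> U [set n | `|x n - l| < e].
Proof.
move=> xM; pose A := [set t | U [set n | t <= x n]].
have UT : U setT by exact: filterT.
have A0 : A (- M).
  apply: filterS UT => n _ /=.
  by have := xM n; rewrite ler_norml => /andP[].
have Aub : has_ubound A.
  exists M => t At; have [n /= tx] := ultra_nonempty At.
  by rewrite (le_trans tx)// (le_trans (ler_norm _) (xM n)).
exists (sup A) => e e0.
have [t At lt] : exists2 t, A t & sup A - e < t.
  by apply: sup_adherent => //; split=> //; exists (- M).
have h : ~ A (sup A + e / 2).
  by move=> h; have := ub_le_sup Aub h; lra.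
apply: filterS (filterI At (ultra_compl h)) => n [/= h1 /negP].
rewrite -ltNge => h2; rewrite ltr_norml; apply/andP; split; lra.
Qed.

Lemma ultra_lim (z : nat -> R[i]) (M : R) : (forall n, nrm (z n) <= M) ->
  exists l, forall e, 0 < e -> U [set n | nrm (z n - l) < e].
Proof.
move=> zM.
have [|a aP] := @ultra_lim_real (fun n => complex.Re (z n)) M.
  by move=> n; rewrite (le_trans (nrm_Re _)).
have [|b bP] := @ultra_lim_real (fun n => complex.Im (z n)) M.
  by move=> n; rewrite (le_trans (nrm_Im _)).
exists (a +i* b)%C => e e0.
have e2 : 0 < e / 2 by rewrite divr_gt0.
apply: filterS (filterI (aP _ e2) (bP _ e2)) => n [/= h1 h2].
rewrite (le_lt_trans (nrm_ReIm _))//.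
by case: (z n) h1 h2 => p q /=; lra.
Qed.

End FreeUltrafilter.

Section Completeness.
Context {R : realType}.
Implicit Types V : normedZmodType R[i].

Definition seq_cauchy V (u : nat -> V) : Prop := forall e : R, 0 < e ->
  exists N, forall m n, (N <= m)%N -> (N <= n)%N -> nrm (u m - u n) < e.

Definition seq_lim V (u : nat -> V) (l : V) : Prop := forall e : R, 0 < e ->
  exists N, forall n, (N <= n)%N -> nrm (u n - l) < e.

Definition seq_complete V : Prop :=
  forall u : nat -> V, seq_cauchy u -> exists l, seq_lim u l.

Lemma geometric_limit V (u : nat -> V) (eta : R) : seq_complete V ->
  (forall n, nrm (u n.+1 - u n) <= eta * 2^-1 ^+ n.+1) ->
  exists l, seq_lim u l /\ forall n, nrm (l - u n) <= eta * 2^-1 ^+ n.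
Proof.
move=> cV ustep.
have eta0 : 0 <= eta.
  have := le_trans (nrm_ge0 _) (ustep 0).
  by rewrite pmulr_lge0// half_expr_gt0.
have dist n k : nrm (u (n + k)%N - u n) <= eta * (2^-1 ^+ n - 2^-1 ^+ (n + k)).
  elim: k => [|k IH]; first by rewrite addn0 !subrr nrm0 mulr0.
  rewrite addnS (le_trans (nrm_tri _ (u (n + k)%N) _))//.
  rewrite (le_trans (lerD (ustep _) IH))// -mulrDr ler_wpM2l//.
  by rewrite half_exprS; lra.
have dist' n m : (n <= m)%N -> nrm (u m - u n) <= eta * 2^-1 ^+ n.
  move=> /subnKC <-; rewrite (le_trans (dist _ _))// ler_wpM2l//.
  by rewrite gerBl ltW// half_expr_gt0.
have [|l ul] := cV u.
  (* The factor 2 pays for passing through u N, the summand 1 for the case eta = 0. *)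
  move=> e e0; have [|N NP] := @half_expr_small R (e / (2 * (eta + 1))).
    by rewrite divr_gt0// mulr_gt0// ltr_wpDl.
  exists N => m n Nm Nn; rewrite (le_lt_trans (nrm_tri _ (u N) _))//.
  have := NP N (leqnn _); rewrite ltr_pdivlMr; last by rewrite mulr_gt0// ltr_wpDl.
  have := dist' _ _ Nm; have := dist' _ _ Nn; rewrite (nrm_sub (u N)).
  have := half_expr_gt0 (R := R) N; nra.
exists l; split=> // n; apply/ler_addgt0Pl => e e0.
have [N NP] := ul _ e0.
have := NP _ (leq_maxl N n); have := dist' _ _ (leq_maxr N n).
have := nrm_tri l (u (maxn N n)) (u n).
by rewrite (nrm_sub l (u (maxn _ _))); lra.
Qed.

Lemma seq_lim_unique V (u : nat -> V) l l' :
  seq_lim u l -> seq_lim u l' -> l = l'.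
Proof.
move=> ul ul'; apply/eqP; rewrite -subr_eq0; apply/eqP/nrm0_eq0.
apply/eqP; rewrite eq_le nrm_ge0 andbT; apply/ler_addgt0Pl => e e0.
have e2 : 0 < e / 2 by rewrite divr_gt0.
have [N NP] := ul _ e2; have [M MP] := ul' _ e2.
have := NP _ (leq_maxl N M); have := MP _ (leq_maxr N M).
have := nrm_tri l (u (maxn N M)) l'.
by rewrite (nrm_sub l (u (maxn _ _))); lra.
Qed.

(** A tail is bounded and so has an ultralimit, and a Cauchy sequence converges to any value that it
    keeps approaching. *)
Lemma complex_seq_complete : seq_complete R[i].
Proof.
move=> u uc; have [U [UU Uoo]] := free_ultrafilter.
have [N NP] := uc 1 ltr01.
pose v n := u (n + N)%N.
have [|l lP] := @ultra_lim R U UU v (nrm (u N) + 1).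
  move=> n; have := NP (n + N)%N N (leq_addl _ _) (leqnn _).
  by have := nrm_rev (v n) (u N); rewrite /v; lra.
exists l => e e0; have e2 : 0 < e / 2 by rewrite divr_gt0.
have [M MP] := uc _ e2; exists M => n Mn.
have [m [/= h1 h2]] := ultra_nonempty (filterI (lP _ e2) (Uoo M)).
have := MP _ (m + N)%N Mn (leq_trans h2 (leq_addr _ _)).
have := nrm_tri (u n) (v m) l; rewrite -/(v m); lra.
Qed.

Lemma complete_seq_complete (X : completeNormedModType R[i]) : seq_complete X.
Proof.
move=> u uc.
have /cauchy_cvgP : cauchy (u @ \oo).
  apply: cauchy_exP => e e0.
  have eE : e = (complex.Re e)%:C by rewrite RRe_real// gtr0_real.
  have [|N NP] := uc (complex.Re e); first by rewrite -ltcR -eE.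
  exists (u N); apply: filterS (nbhs_infty_ge N) => n /= Nn.
  rewrite -ball_normE /ball_/= eE -nrmE ltcR.
  exact: NP.
move=> /cvg_ex[l /cvgrPdist_lt ul]; exists l => e e0.
have [|N _ NP] := ul e%:C; first by rewrite ltcR.
by exists N => n Nn; have := NP n Nn; rewrite /= -nrmE ltcR nrm_sub.
Qed.

Lemma bop_seq_complete (X Y : normedModType R[i]) :
  seq_complete Y -> seq_complete (bop X Y).
Proof.
move=> cY F Fc.
have Fx x : exists l, seq_lim (fun n => F n x) l.
  apply: cY => e e0.
  have [|N NP] := Fc (e / (nrm x + 1)).
    by rewrite divr_gt0// ltr_wpDl ?nrm_ge0.
  exists N => m n Nm Nn.
  have := NP m n Nm Nn; rewrite ltr_pdivlMr ?ltr_wpDl ?nrm_ge0//.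
  have := bop_le (F m - F n) x; have := nrm_ge0 (F m - F n).
  by rewrite bopDE bopNE; nra.
have [f fP] := choice Fx.
have flin : linear f.
  move=> a x y; apply: (seq_lim_unique (fP _)) => e e0.
  have [|N NP] := fP x (e / (2 * (nrm a + 1))).
    by rewrite divr_gt0// mulr_gt0// ltr_wpDl ?nrm_ge0.
  have [|M MP] := fP y (e / 2); first by rewrite divr_gt0.
  exists (maxn N M) => n; rewrite geq_max => /andP[Nn Mn].
  have := NP n Nn; rewrite ltr_pdivlMr; last by rewrite mulr_gt0// ltr_wpDl ?nrm_ge0.
  have := MP n Mn; rewrite linearP.
  have -> : a *: F n x + F n y - (a *: f x + f y) =
            a *: (F n x - f x) + (F n y - f y).
    by rewrite scalerBr opprD addrACA.
  have := nrmD (a *: (F n x - f x)) (F n y - f y); rewrite nrmZ.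
  have := nrm_ge0 a; have := nrm_ge0 (F n x - f x); nra.
have close e : 0 < e -> exists N, forall n, (N <= n)%N ->
    forall x, nrm (F n x - f x) <= e * nrm x.
  move=> e0; have [N NP] := Fc _ e0; exists N => n Nn x.
  apply/ler_addgt0Pl => d d0.
  have [M MP] := fP x d d0.
  have := MP _ (leq_maxl M N).
  have := NP n _ Nn (leq_maxr M N).
  have := bop_le (F n - F (maxn M N)) x; rewrite bopDE bopNE.
  have := nrm_tri (F n x) (F (maxn M N) x) (f x).
  by have := nrm_ge0 x; nra.
have [N NP] := close 1 ltr01.
have [|G GP] := @make_bop R X Y f (nrm (F N) + 1) flin.
  move=> x; have := NP N (leqnn _) x; have := bop_le (F N) x.
  have := nrm_rev (f x) (F N x); rewrite (nrm_sub (f x)); lra.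
exists G => e e0; have [|M MP] := close (e / 2); first by rewrite divr_gt0.
exists M => n Mn; apply: (@le_lt_trans _ _ (e / 2)); last lra.
apply: bop_nrm_le => [|x]; first by rewrite divr_ge0// ltW.
by rewrite bopDE bopNE GP; exact: MP.
Qed.

End Completeness.

(** * Interpolating subsequences of functionals *)

Section SeqChoice.

(** Dependent choice for greedy constructions whose next term depends on all earlier ones: the
    invariant bears on the finite history. *)
Lemma seq_choice (A : Type) (valid : seq A -> Prop) : valid [::] ->
  (forall s, valid s -> exists a, valid (rcons s a)) ->
  exists x : nat -> A, forall n, valid (mkseq x n).
Proof.
move=> v0 vS.
have [next nextP] : exists f : {s | valid s} -> A,
    forall s, valid (rcons (sval s) (f s)).
  pose P (s : {s | valid s}) a := valid (rcons (sval s) a).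
  by have [|f fP] := @choice _ _ P; [case=> s vs; exact: vS|exists f].
pose g := fix g n : {s | valid s} := if n is n'.+1
  then exist _ _ (nextP (g n')) else exist _ _ v0.
exists (next \o g) => n.
suff <- : sval (g n) = mkseq (next \o g) n by exact: svalP.
by elim: n => //= n IH; rewrite mkseqS -IH.
Qed.

Lemma filter_forall_lt (T : Type) (F : set_system T) {FF : Filter F}
    (m : nat) (Q : nat -> set T) :
  (forall j, (j < m)%N -> F (Q j)) -> F [set x | forall j, (j < m)%N -> Q j x].
Proof.
elim: m => [|m IH] FQ; first by apply: filterS filterT => x _ j.
have h : F [set x | forall j, (j < m)%N -> Q j x].
  by apply: IH => j jm; apply: FQ; rewrite ltnS ltnW.
apply: filterS (filterI h (FQ m (ltnSn m))) => x [/= h1 h2] j.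
by rewrite ltnS leq_eqVlt => /predU1P[->|/h1].
Qed.

End SeqChoice.

Section BiorthogonalSubsequence.
Context {R : realType} {W : normedModType R[i]}.
Context (phi : nat -> W -> R[i]) (psi : W -> R[i]).
Context (U : set_system nat) {UU : UltraFilter U}.
Context (gam : nat -> R) (d : R).
Hypothesis phiL :
  forall n a x y, phi n (a *: x + y) = a * phi n x + phi n y.
Hypothesis phi_le : forall n x, nrm (phi n x) <= nrm x.
Hypothesis psi_lim :
  forall x e, 0 < e -> U [set n | nrm (phi n x - psi x) < e].
Hypothesis d0 : 0 < d.
Hypothesis phi_far :
  U [set n | exists x, nrm x <= 1 /\ d <= nrm (phi n x - psi x)].
Hypothesis gam_lim : forall e, 0 < e -> U [set n | gam n < e].

Let phiD n x y : phi n (x + y) = phi n x + phi n y.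
Proof. by have := phiL n 1 x y; rewrite scale1r mul1r. Qed.

Let phi0 n : phi n 0 = 0.
Proof. by apply: (addrI (phi n 0)); rewrite -phiD !addr0. Qed.

Let phiZ n a x : phi n (a *: x) = a * phi n x.
Proof. by have := phiL n a x 0; rewrite phi0 !addr0. Qed.

Let phiB n x y : phi n (x - y) = phi n x - phi n y.
Proof. by rewrite phiD -scaleN1r phiZ mulN1r. Qed.

Let nrm_small (a : R[i]) : (forall e, 0 < e -> nrm a <= e) -> a = 0.
Proof.
move=> h; apply/nrm0_eq0/eqP; rewrite eq_le nrm_ge0 andbT.
by apply/ler_addgt0Pl => e e0; rewrite addr0 h.
Qed.

Let psi_le x : nrm (psi x) <= nrm x.
Proof.
apply/ler_addgt0Pl => e e0; have [n /= h] := ultra_nonempty (psi_lim x e0).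
have := phi_le n x; have := nrm_rev (psi x) (phi n x).
by rewrite (nrm_sub (psi x)); lra.
Qed.

Let psiL a x y : psi (a *: x + y) = a * psi x + psi y.
Proof.
apply/eqP; rewrite -subr_eq0; apply/eqP/nrm_small => e e0.
have ea : 0 < e / (3 * (nrm a + 1)).
  by rewrite divr_gt0// mulr_gt0// ltr_wpDl ?nrm_ge0.
have e3 : 0 < e / 3 by rewrite divr_gt0.
have [n [/= h1 [h2 h3]]] := ultra_nonempty (filterI (psi_lim x ea)
  (filterI (psi_lim y e3) (psi_lim (a *: x + y) e3))).
have -> : psi (a *: x + y) - (a * psi x + psi y) =
  (a * (phi n x - psi x) + (phi n y - psi y)) -
  (phi n (a *: x + y) - psi (a *: x + y)).
  by rewrite phiL; ring.
have := nrmB (a * (phi n x - psi x) + (phi n y - psi y))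
  (phi n (a *: x + y) - psi (a *: x + y)).
have := nrmD (a * (phi n x - psi x)) (phi n y - psi y).
move: h1; rewrite nrmM ltr_pdivlMr; last by rewrite mulr_gt0// ltr_wpDl ?nrm_ge0.
by have := nrm_ge0 a; have := nrm_ge0 (phi n x - psi x); nra.
Qed.

Let psiD x y : psi (x + y) = psi x + psi y.
Proof. by have := psiL 1 x y; rewrite scale1r mul1r. Qed.

Let psi0 : psi 0 = 0.
Proof. by apply: (addrI (psi 0)); rewrite -psiD !addr0. Qed.

Let psiZ a x : psi (a *: x) = a * psi x.
Proof. by have := psiL a x 0; rewrite psi0 !addr0. Qed.

Let psiB x y : psi (x - y) = psi x - psi y.
Proof. by rewrite psiD -scaleN1r psiZ mulN1r. Qed.

(* [P] plays the role of a finite-corank projection into the common kernel of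
   [psi] and of the [phi j], [j \in s]; along [U] the functional
   [phi n \o P] gets uniformly close to [phi n - psi], hence stays large. *)
Definition projector (s : seq nat) (P : W -> W) (C : R) : Prop :=
  [/\ 0 < C, forall x, nrm (P x) <= C * nrm x, forall x, psi (P x) = 0,
      forall j x, j \in s -> phi j (P x) = 0
    & forall e, 0 < e ->
        U [set n | forall x,
          nrm (phi n (P x) - (phi n x - psi x)) <= e * nrm x]].

(** If psi is nonzero, subtracting the component along a w with psi w = 1 leaves the error psi x
    (phi n w - psi w), which tends to 0 uniformly on the unit ball. *)
Lemma projector_nil : exists P C, projector [::] P C.
Proof.
have [h|] := pselect (forall x, psi x = 0).
  exists id, 1; split=> //; first by move=> x; rewrite mul1r.
  move=> e e0; apply: filterS filterT => n _ x.
  by rewrite h subr0 subrr nrm0 mulr_ge0 ?nrm_ge0// ltW.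
move=> /existsNP[y /eqP y0]; pose w := (psi y)^-1 *: y.
have w1 : psi w = 1 by rewrite psiZ mulVf.
exists (fun x => x - psi x *: w), (1 + nrm w); split=> //.
- by rewrite ltr_pwDl ?nrm_ge0.
- move=> x; have := nrmB x (psi x *: w); rewrite nrmZ.
  by have := psi_le x; have := nrm_ge0 w; nra.
- by move=> x; rewrite psiB psiZ w1 mulr1 subrr.
- move=> e e0; apply: filterS (psi_lim w e0) => n /= wn x.
  have -> : phi n (x - psi x *: w) - (phi n x - psi x) =
            - (psi x * (phi n w - psi w)).
    by rewrite phiB phiZ w1; ring.
  rewrite nrmN nrmM mulrC; apply: ler_pM; rewrite ?nrm_ge0//.
  exact: ltW.
Qed.

Lemma projector_vector s P C : projector s P C ->
  U [set n | exists z, [/\ phi n z = 1, nrm z <= 2 * C / d, psi z = 0 &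
    forall j, j \in s -> phi j z = 0]].
Proof.
move=> [C0 PC psiP phiP closeP].
have d2 : 0 < d / 2 by rewrite divr_gt0.
apply: filterS (filterI phi_far (closeP _ d2)) => n [/= [x [x1 dx]] hx].
have big : d / 2 <= nrm (phi n (P x)).
  have := hx x; have := nrm_rev (phi n x - psi x) (phi n (P x)).
  rewrite (nrm_sub (phi n x - psi x)); have := nrm_ge0 x; nra.
have nz : phi n (P x) != 0 by rewrite -nrm_gt0 (lt_le_trans d2).
(* |P x| is at most C and |phi n (P x)| at least d / 2, whence the bound 2 C / d. *)
exists ((phi n (P x))^-1 *: P x); split.
- by rewrite phiZ mulVf.
- rewrite nrmZ nrmV mulrC ler_pdivrMr ?nrm_gt0//.
  rewrite (le_trans (PC x))// (@le_trans _ _ C)//.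
    by rewrite ler_piMr// ltW.
  rewrite mulrAC ler_pdivlMr//.
  by rewrite -subr_ge0; nra.
- by rewrite psiZ psiP mulr0.
- by move=> j js; rewrite phiZ (phiP _ _ js) mulr0.
Qed.

(** One more functional is split off along z; since psi z = 0, the additional error phi n (P x) phi
    m z tends to 0 in m along [U], uniformly on the unit ball. *)
Lemma projector_rcons s P C n z : projector s P C -> phi n z = 1 ->
    psi z = 0 -> (forall j, j \in s -> phi j z = 0) ->
  exists P' C', projector (rcons s n) P' C'.
Proof.
move=> [C0 PC psiP phiP closeP] z1 pz kz.
exists (fun x => P x - phi n (P x) *: z), (C + C * nrm z); split.
- by rewrite ltr_wpDr// mulr_ge0 ?nrm_ge0// ltW.
- move=> x; have := nrmB (P x) (phi n (P x) *: z); rewrite nrmZ.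
  by have := phi_le n (P x); have := PC x; have := nrm_ge0 z; nra.
- by move=> x; rewrite psiB psiZ psiP pz mulr0 subrr.
- move=> j x; rewrite mem_rcons inE => /predU1P[->|js].
    by rewrite phiB phiZ z1 mulr1 subrr.
  by rewrite phiB phiZ (phiP _ _ js) kz// mulr0 subrr.
- move=> e e0; have e2 : 0 < e / 2 by rewrite divr_gt0.
  have eC : 0 < e / (2 * C) by rewrite divr_gt0// mulr_gt0.
  apply: filterS (filterI (closeP _ e2) (psi_lim z eC)) => m [/= h1 h2] x.
  have -> : phi m (P x - phi n (P x) *: z) - (phi m x - psi x) =
    (phi m (P x) - (phi m x - psi x)) - phi n (P x) * phi m z.
    by rewrite phiB phiZ; ring.
  apply: le_trans (nrmB _ _) _.
  move: h2; rewrite pz subr0 ltr_pdivlMr ?mulr_gt0// nrmM => h2.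
  have h3 : nrm (phi n (P x)) * nrm (phi m z) <= C * nrm x * nrm (phi m z).
    by rewrite ler_wpM2r ?nrm_ge0// (le_trans (phi_le _ _)).
  have := h1 x; have := nrm_ge0 x; nra.
Qed.

(** With x k = (n k, z k), the matrix of the values of phi (n k) at z j has unit diagonal, zeros on
    one side and small entries on the other, so interpolation is forward substitution. The weight 1
    + |z k| makes the corrections summable in norm, and the last clause puts data of size gam within
    reach. *)
Definition triangular (x : nat -> nat * W) (k : nat) : Prop :=
  [/\ phi (x k).1 (x k).2 = 1, psi (x k).2 = 0,
      forall j, (j < k)%N -> phi (x j).1 (x k).2 = 0,
      forall j, (j < k)%N ->
        nrm (phi (x k).1 (x j).2) <= 2^-1 ^+ k.+2 / (1 + nrm (x k).2)
    & gam (x k).1 <= 2^-1 ^+ k.+2 / (1 + nrm (x k).2)].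

Lemma triangular_ext x y k : (forall j, (j <= k)%N -> x j = y j) ->
  triangular x k -> triangular y k.
Proof.
move=> xy [h1 h2 h3 h4 h5]; split; rewrite -?(xy k)//.
  by move=> j jk; rewrite -(xy j) ?h3// ltnW.
by move=> j jk; rewrite -(xy j) ?h4// ltnW.
Qed.

Lemma triangular_exists : exists x, forall k, triangular x k.
Proof.
pose x0 : nat * W := (0%N, 0).
pose valid s := (forall k, (k < size s)%N -> triangular (nth x0 s) k) /\
  exists P C, projector (map fst s) P C.
have [||x xP] := @seq_choice _ valid.
- by split=> //; exact: projector_nil.
- move=> s [sT [P [C sP]]].
  have C0 : 0 < C by case: sP.
  (* The tolerance depends on the norm of the new vector, which is known only once n is chosen; K
     bounds it in advance. *)
  pose K := 2 * C / d; have K0 : 0 < K by rewrite divr_gt0// mulr_gt0.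
  pose dl := 2^-1 ^+ (size s).+2 / (1 + K).
  have dl0 : 0 < dl by rewrite divr_gt0 ?half_expr_gt0// addr_gt0.
  have small : U [set n | forall j, (j < size s)%N ->
      nrm (phi n (nth x0 s j).2) < dl].
    apply: filter_forall_lt => j js; have [_ pz _ _ _] := sT j js.
    by apply: filterS (psi_lim (nth x0 s j).2 dl0) => n; rewrite /= pz subr0.
  have [n [/= [z [z1 zK pz kz]] [h1 h2]]] := ultra_nonempty
    (filterI (projector_vector sP) (filterI small (gam_lim dl0))).
  have dl_le : dl <= 2^-1 ^+ (size s).+2 / (1 + nrm z).
    rewrite /dl ler_wpM2l ?(ltW (half_expr_gt0 _))//.
    rewrite lef_pV2 ?posrE ?lerD2l//; first exact: addr_gt0.
    by rewrite ltr_pwDl ?nrm_ge0.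
  exists (n, z); split; last first.
    by rewrite map_rcons; exact: projector_rcons sP z1 pz kz.
  have nths j : (j < size s)%N -> nth x0 (rcons s (n, z)) j = nth x0 s j.
    by move=> js; rewrite nth_rcons js.
  move=> k; rewrite size_rcons ltnS leq_eqVlt => /predU1P[->|ks]; last first.
    apply: triangular_ext (sT k ks) => j jk; rewrite nths//.
    exact: leq_ltn_trans ks.
  have nthl : nth x0 (rcons s (n, z)) (size s) = (n, z).
    by rewrite nth_rcons ltnn eqxx.
  split; rewrite ?nthl//=.
  + move=> j js; rewrite nths//; apply: kz; apply: map_f.
    exact: mem_nth.
  + by move=> j js; rewrite nths// (le_trans (ltW (h1 j js))).
  + by rewrite (le_trans (ltW h2)).
exists x => k; have [h _] := xP k.+1.
apply: triangular_ext (h k _); last by rewrite size_mkseq.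
by move=> j jk; rewrite nth_mkseq.
Qed.

Lemma triangular_solve (x : nat -> nat * W) (c : nat -> R[i]) :
    seq_complete W -> (forall k, triangular x k) ->
    (forall k, nrm (c k) <= 2^-1 ^+ k.+2 / (1 + nrm (x k).2)) ->
  exists z, nrm z <= 1 /\ forall k, phi (x k).1 z = c k.
Proof.
move=> cW xT cw.
(* Forward substitution: S m meets the first m conditions, and its next increment is the residual b
   m times the m-th vector. *)
pose S := fix S m := if m is m'.+1
  then S m' + (c m' - phi (x m').1 (S m')) *: (x m').2 else 0.
pose b m := c m - phi (x m).1 (S m).
have w0 m : 0 < 1 + nrm (x m).2 by rewrite ltr_pwDl ?nrm_ge0.
have exact j m : (j < m)%N -> phi (x j).1 (S m) = c j.
  elim: m => // m IH; rewrite ltnS leq_eqVlt /= phiD phiZ => /predU1P[->|jm].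
    by have [-> _ _ _ _] := xT m; rewrite mulr1 addrC subrK.
  by have [_ _ h _ _] := xT m; rewrite h// mulr0 addr0 IH.
(* The datum and the value already taken by S m are each at most 2^-(m+2) over the weight. The
   induction statement is a hypothesis because this bound serves both inside the induction for
   [Sphi] and after it. *)
have bound m : (forall t dl, 0 <= dl ->
      (forall i, (i < m)%N -> nrm (phi t (x i).2) <= dl) ->
      nrm (phi t (S m)) <= dl * (1 - 2^-1 ^+ m)) ->
    nrm (b m) * (1 + nrm (x m).2) <= 2^-1 ^+ m.+1.
  move=> IH; have [_ _ _ h _] := xT m.
  have {}h := IH _ _ (le_trans (nrm_ge0 _) (cw m)) h.
  rewrite -ler_pdivlMr// (le_trans (nrmB _ _))//.
  rewrite (le_trans (lerD (cw m) h))//.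
  rewrite (half_exprS m.+1); have := half_expr_gt0 (R := R) m.
  have := half_expr_gt0 (R := R) m.+1.
  set q := (1 + nrm (x m).2)^-1; have : 0 < q by rewrite invr_gt0.
  move: (2^-1 ^+ m.+1) (2^-1 ^+ m) => p r q0 p0 r0.
  have := mulr_gt0 (mulr_gt0 p0 q0) r0; lra.
(* The coefficients b i are at most 2^-(i+1), and these bounds add up to 1 - 2^-m. *)
have Sphi m : forall t dl, 0 <= dl ->
    (forall i, (i < m)%N -> nrm (phi t (x i).2) <= dl) ->
    nrm (phi t (S m)) <= dl * (1 - 2^-1 ^+ m).
  elim: m => [|m IH] t dl dl0 h /=.
    by rewrite phi0 nrm0 subrr mulr0.
  rewrite phiD phiZ (le_trans (nrmD _ _))// nrmM -/(b m).
  have h1 : nrm (phi t (S m)) <= dl * (1 - 2^-1 ^+ m).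
    by apply: IH => // i im; apply: h; rewrite ltnS ltnW.
  have h2 := h m (ltnSn m).
  have h3 : nrm (b m) <= 2^-1 ^+ m.+1.
    apply: le_trans (bound m IH); rewrite ler_peMr ?nrm_ge0//.
    by rewrite lerDl nrm_ge0.
  have h4 : nrm (b m) * nrm (phi t (x m).2) <= 2^-1 ^+ m.+1 * dl.
    by apply: ler_pM; rewrite ?nrm_ge0.
  move: h3 h4; rewrite half_exprS; lra.
have step m : nrm (S m.+1 - S m) <= 1 * 2^-1 ^+ m.+1.
  rewrite /= addrC addKr nrmZ mul1r -/(b m) (le_trans _ (bound m (Sphi m)))//.
  by rewrite ler_wpM2l ?nrm_ge0// lerDr.
have [l [_ lP]] := geometric_limit cW step.
exists l; split; first by have := lP 0%N; rewrite subr0 mulr1.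
move=> k; apply/eqP; rewrite -subr_eq0; apply/eqP/nrm_small => e e0.
have [N NP] := half_expr_small e0.
have -> : phi (x k).1 l - c k = phi (x k).1 (l - S (maxn N k.+1)).
  by rewrite phiB (exact k)// leq_maxr.
rewrite (le_trans (phi_le _ _))// (le_trans (lP _))// mul1r.
by rewrite ltW// NP// leq_maxl.
Qed.

(** [w] bounds the data that a vector of the unit ball can interpolate. That it dominates gam lets
    one vector take values proportional to 1 / |h n|; its positivity yields biorthogonal vectors. *)
Theorem interpolating_subsequence : seq_complete W ->
  exists (n : nat -> nat) (w : nat -> R),
    [/\ forall k, 0 < w k, forall k, gam (n k) <= w k &
      forall c : nat -> R[i], (forall k, nrm (c k) <= w k) ->
        exists z, nrm z <= 1 /\ forall k, phi (n k) z = c k].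
Proof.
move=> cW; have [x xT] := triangular_exists.
exists (fun k => (x k).1), (fun k => 2^-1 ^+ k.+2 / (1 + nrm (x k).2)); split.
- by move=> k; rewrite divr_gt0 ?half_expr_gt0// ltr_pwDl ?nrm_ge0.
- by move=> k; have [] := xT k.
- by move=> c cw; exact: triangular_solve cw.
Qed.

End BiorthogonalSubsequence.

(** * Approximate eigenvectors *)

Section UniformBoundedness.
Context {R : realType} {V : normedModType R[i]}.

(** T (x + y) and T (x - y) differ by 2 T y, so one of them is at least |T y|. The factor 3/4 stands
    in for a norm that may not be attained. *)
Lemma bop_large_near (T : bop V V) (x : V) (r : R) : 0 < nrm T -> 0 < r ->
  exists y, nrm (y - x) <= r /\ 3 / 4 * r * nrm T <= nrm (T y).
Proof.
move=> T0 r0; have [||z [z0 Tz]] := @bop_gt_nrm _ _ _ T (3 / 4 * nrm T).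
- lra.
- lra.
pose y := (r / nrm z)%:C *: z.
have nz : 0 < nrm z by rewrite nrm_gt0.
have ny : nrm y = r.
  by rewrite nrmZ nrmC ger0_norm ?divfK ?gt_eqF// ltW// divr_gt0.
have Ty : 3 / 4 * r * nrm T <= nrm (T y).
  rewrite linearZ nrmZ nrmC ger0_norm; last by rewrite ltW// divr_gt0.
  rewrite -ler_pdivrMl ?divr_gt0// invf_div mulrC [leLHS](_ : _ =
    3 / 4 * nrm T * nrm z); first exact: ltW.
  by field; rewrite gt_eqF.
have h : nrm (T y) + nrm (T y) <= nrm (T (x + y)) + nrm (T (x - y)).
  apply: le_trans (nrmB _ _).
  have -> : T (x + y) - T (x - y) = (2%:R : R)%:C *: T y.
    rewrite (rmorph_nat (real_complex R)) scaler_nat mulr2n.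
    by rewrite linearB linearD opprB addrC addrA subrK.
  by rewrite nrmZ nrmC ger0_norm// mulr_natl mulr2n.
have [h1|h1] := leP (nrm (T y)) (nrm (T (x + y))).
  by exists (x + y); rewrite addrC addKr ny; split=> //; exact: le_trans h1.
exists (x - y); rewrite addrC addKr nrmN ny; split=> //.
by apply: le_trans Ty _; lra.
Qed.

(** [geometric_limit], applied to each tail, yields the constant 1/2. It has to be below the 3/4 of
    [bop_large_near]: passing from u n to the limit leaves 3/4 - 1/2 = 1/4. *)
Lemma quarter_limit (u : nat -> V) : seq_complete V ->
  (forall n, nrm (u n.+1 - u n) <= 4^-1 ^+ n.+1) ->
  exists l, forall n, nrm (l - u n) <= 4^-1 ^+ n / 2.
Proof.
move=> cV ustep.
have q n : (4^-1 : R) ^+ n = 2^-1 ^+ n * 2^-1 ^+ n.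
  by rewrite -exprMn -invfM -natrM.
have [|l [ul _]] := @geometric_limit _ _ u 1 cV.
  move=> n; rewrite mul1r (le_trans (ustep n))// q ler_piMr//.
    exact/ltW/half_expr_gt0.
  exact: half_expr_le1.
exists l => n.
have [|l' [ul' l'P]] := @geometric_limit _ _ (fun k => u (n + k)%N) (4^-1 ^+ n / 2) cV.
  move=> k; rewrite addnS (le_trans (ustep _))// -addnS exprD -mulrA.
  apply: ler_wpM2l; first by rewrite exprn_ge0// invr_ge0.
  rewrite q ler_wpM2r ?(ltW (half_expr_gt0 _))// half_exprS.
  by have := half_expr_le1 (R := R) k; lra.
have -> : l = l'.
  apply: (@seq_lim_unique _ _ (fun k => u (n + k)%N)) => // e e0.
  have [N NP] := ul _ e0; exists N => k Nk.
  by rewrite NP// (leq_trans Nk)// leq_addl.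
by have := l'P 0%N; rewrite expr0 mulr1 addn0.
Qed.

(* Sokal's proof of the uniform boundedness principle. *)
Lemma unbounded_orbit (T : nat -> bop V V) : seq_complete V ->
  (forall n, 8 ^+ n <= nrm (T n)) ->
  exists e, forall n, 2 ^+ n / 4 <= nrm (T n e).
Proof.
move=> cV T8.
have T0 n : 0 < nrm (T n) by rewrite (lt_le_trans _ (T8 n))// exprn_gt0.
have q0 n : 0 < (4^-1 : R) ^+ n by rewrite exprn_gt0// invr_gt0.
have [f fP] : exists f : nat * V -> V, forall p, nrm (f p - p.2) <= 4^-1 ^+ p.1 /\
    3 / 4 * 4^-1 ^+ p.1 * nrm (T p.1) <= nrm (T p.1 (f p)).
  have [|f fP] := @choice _ _ (fun (p : nat * V) y => nrm (y - p.2) <= 4^-1 ^+ p.1 /\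
    3 / 4 * 4^-1 ^+ p.1 * nrm (T p.1) <= nrm (T p.1 y)); last by exists f.
  by move=> p; exact: bop_large_near.
pose u := fix u n := if n is n'.+1 then f (n, u n') else f (0%N, 0).
have [|l lP] := @quarter_limit u cV; first by move=> n; have [] := fP (n.+1, u n).
exists l => n.
have h1 : 3 / 4 * 4^-1 ^+ n * nrm (T n) <= nrm (T n (u n)).
  case: n => [|n]; first by have [] := fP (0%N, 0).
  by have [] := fP (n.+1, u n).
have h2 := nrm_rev (T n (u n)) (T n (u n - l)).
have e : T n (u n) - T n (u n - l) = T n l by rewrite linearB subKr.
rewrite e in h2.
have h3 := bop_le (T n) (u n - l); rewrite nrm_sub in h3.
have h4 : nrm (T n) * nrm (l - u n) <= nrm (T n) * (4^-1 ^+ n / 2).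
  by rewrite ler_wpM2l ?nrm_ge0.
have h5 : 2 ^+ n <= 4^-1 ^+ n * nrm (T n).
  rewrite exprVn mulrC ler_pdivlMr ?exprn_gt0// -exprMn -natrM.
  exact: T8.
move: h1 h2 h3 h4 h5; move: (nrm (T n)) (4^-1 ^+ n) => a b; lra.
Qed.

End UniformBoundedness.

(** * Blow-up of resolvents in a dual pairing *)

Section PairingCore.
Context {R : realType} {B W : normedModType R[i]} (be : B -> W -> R[i]).
Hypothesis beLl : forall w a b c, be (a *: b + c) w = a * be b w + be c w.
Hypothesis beLr : forall b a v w, be b (a *: v + w) = a * be b v + be b w.
Hypothesis be_le : forall b w, nrm (be b w) <= nrm b * nrm w.
Hypothesis be_norming : forall b (M : R), 0 <= M ->
  (forall w, nrm w <= 1 -> nrm (be b w) <= M) -> nrm b <= M.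
Hypotheses (cB : seq_complete B) (cW : seq_complete W).
Context (S : bop B B) (mu : R[i]) (lam : nat -> R[i]) (Rs : nat -> bop B B).
Hypothesis RsP : forall n b, S (Rs n b) = lam n *: Rs n b + b.
Hypothesis lamP : forall n, nrm (lam n - mu) <= 2^-1 ^+ n.
Hypothesis Rs_large : forall n, 8 ^+ n <= nrm (Rs n).
Hypothesis mu_inj : forall b, S b = mu *: b -> b = 0.

Let beZr b a w : be b (a *: w) = a * be b w.
Proof.
have be0 : be b 0 = 0.
  have := beLr b 1 0 0; rewrite scaler0 addr0 mul1r => h.
  by apply: (addrI (be b 0)); rewrite addr0 -h.
by have := beLr b a w 0; rewrite be0 !addr0.
Qed.

Let beB w b c : be (b - c) w = be b w - be c w.
Proof.
by have := beLl w (-1) c b; rewrite scaleN1r mulN1r addrC => ->; rewrite addrC.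
Qed.

(* Along [U] the normalised orbit [x n] is a sequence of approximate
   eigenvectors, so a norm limit would be an eigenvector for [mu]. *)
Lemma approx_eigenvectors_far (U : set_system nat) (UU : UltraFilter U)
    (x : nat -> B) (psi : W -> R[i]) : (forall N, U [set n | (N <= n)%N]) ->
    (forall n, nrm (x n) = 1) ->
    (forall e, 0 < e ->
      exists N, forall n, (N <= n)%N -> nrm (S (x n) - mu *: x n) < e) ->
  exists2 d, 0 < d &
    U [set n | exists w, nrm w <= 1 /\ d <= nrm (be (x n) w - psi w)].
Proof.
move=> Uoo x1 xmu; apply: contrapT => /forall2NP far.
have close d : 0 < d -> U [set n | forall w, nrm w <= 1 ->
    nrm (be (x n) w - psi w) < d].
  move=> d0; have [//|/(ultra_compl (U := U))] := far d.
  apply: filterS => n /= h w w1; rewrite ltNge; apply/negP => dw.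
  by apply: h; exists w.
have [n nP] : exists n : nat -> nat, forall k, (k <= n k)%N /\ forall w,
    nrm w <= 1 -> nrm (be (x (n k)) w - psi w) < 2^-1 ^+ k.
  have [|n nP] := @choice _ _ (fun k m => (k <= m)%N /\ forall w,
    nrm w <= 1 -> nrm (be (x m) w - psi w) < 2^-1 ^+ k); last by exists n.
  move=> k; have [m [/= h1 h2]] := ultra_nonempty
    (filterI (close _ (half_expr_gt0 (R := R) k)) (Uoo k)).
  by exists m.
(* psi need not come from a vector of [B], but uniform closeness to it on the unit ball of [W] makes
   the subsequence Cauchy in norm. *)
have [|y yP] := cB (u := x \o n).
  move=> e e0; have [|N NP] := @half_expr_small R (e / 3).
    by rewrite divr_gt0.
  exists N => k l Nk Nl /=; apply: (@le_lt_trans _ _ (2 * (e / 3))); last lra.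
  apply: be_norming => [|w w1]; first by rewrite mulr_ge0// divr_ge0// ltW.
  have [_ /(_ w w1)] := nP k; have [_ /(_ w w1)] := nP l.
  have := NP _ Nk; have := NP _ Nl; rewrite beB.
  have := nrm_tri (be (x (n k)) w) (psi w) (be (x (n l)) w).
  by rewrite (nrm_sub (psi w)); lra.
have y0 : y = 0.
  apply: mu_inj; apply/eqP; rewrite -subr_eq0; apply/eqP/nrm0_eq0/eqP.
  rewrite eq_le nrm_ge0 andbT; apply/ler_addgt0Pl => e e0; rewrite addr0.
  have e2 : 0 < e / 2 by rewrite divr_gt0.
  have eK : 0 < e / (2 * (nrm S + nrm mu + 1)).
    by rewrite divr_gt0// mulr_gt0// ltr_wpDl// addr_ge0 ?nrm_ge0.
  have [N NP] := yP _ eK; have [M MP] := xmu _ e2.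
  pose k := maxn N M.
  have := NP k (leq_maxl _ _).
  have := MP (n k) (leq_trans (leq_maxr N M) (nP k).1).
  rewrite /= => h1; rewrite ltr_pdivlMr; last first.
    by rewrite mulr_gt0// ltr_wpDl// addr_ge0 ?nrm_ge0.
  rewrite nrm_sub => h2.
  have -> : S y - mu *: y = S (y - x (n k)) - mu *: (y - x (n k)) +
      (S (x (n k)) - mu *: x (n k)).
    by rewrite linearB scalerBr opprB addrACA subrK addrAC subrr add0r.
  have := nrmD (S (y - x (n k)) - mu *: (y - x (n k)))
    (S (x (n k)) - mu *: x (n k)).
  have := nrmB (S (y - x (n k))) (mu *: (y - x (n k))).
  have := bop_le S (y - x (n k)); rewrite nrmZ.
  by have := nrm_ge0 (y - x (n k)); nra.
have [N NP] := yP 1 ltr01.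
by have := NP N (leqnn N); rewrite y0 subr0 /= x1 ltxx.
Qed.

Theorem resolvent_biorthogonal (eta : R) : 0 < eta ->
  exists (e : B) (x : nat -> B) (nu g : nat -> R[i]) (z : W) (u : nat -> W),
  [/\ e != 0 /\ g 0%N != 0, forall k, S (x k) = nu k *: x k + g k *: e,
      forall k, be (x k) z = - g k,
      forall j k, be (x k) (u j) = (k == j)%:R & nrm z * nrm e < eta].
Proof.
move=> eta0; have [e eP] := unbounded_orbit cB Rs_large.
have a0 n : 0 < nrm (Rs n e).
  by rewrite (lt_le_trans _ (eP n))// divr_gt0// exprn_gt0.
pose a n : R := (nrm (Rs n e))^-1.
have a_gt0 n : 0 < a n by rewrite invr_gt0.
have a_small d : 0 < d -> exists N, forall n, (N <= n)%N -> a n < d.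
  move=> d0; have [|N NP] := @half_expr_small R (d / 4).
    by rewrite divr_gt0.
  exists N => n /NP; rewrite ltr_pdivlMr// => /(le_lt_trans _); apply.
  rewrite /a -[leRHS]invrK lef_pV2 ?posrE ?invr_gt0 ?mulr_gt0 ?half_expr_gt0//.
  by rewrite invfM exprVn invrK.
pose x n := (a n)%:C *: Rs n e.
have x1 n : nrm (x n) = 1.
  by rewrite nrmZ nrmC gtr0_norm// mulVf// gt_eqF.
have Sx n : S (x n) = lam n *: x n + (a n)%:C *: e.
  by rewrite linearZ/= RsP scalerDr !scalerA mulrC.
have xmu d : 0 < d ->
    exists N, forall n, (N <= n)%N -> nrm (S (x n) - mu *: x n) < d.
  move=> d0; have [|N NP] := @half_expr_small R (d / 2).
    by rewrite divr_gt0.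
  have [|M MP] := a_small (d / (2 * (nrm e + 1))).
    by rewrite divr_gt0// mulr_gt0// ltr_wpDl ?nrm_ge0.
  exists (maxn N M) => n; rewrite geq_max => /andP[Nn Mn].
  rewrite Sx addrAC -scalerBl (le_lt_trans (nrmD _ _))//.
  rewrite (nrmZ (lam n - mu)) x1 mulr1 nrmZ.
  rewrite nrmC gtr0_norm//; have := MP _ Mn.
  rewrite ltr_pdivlMr; last by rewrite mulr_gt0// ltr_wpDl ?nrm_ge0.
  by have := NP _ Nn; have := lamP n; have := nrm_ge0 e; have := a_gt0 n; nra.
have [U [UU Uoo]] := free_ultrafilter.
have [psi psiP] : exists psi : W -> R[i], forall w d, 0 < d ->
    U [set n | nrm (be (x n) w - psi w) < d].
  have [|psi psiP] := @choice _ _ (fun w l => forall d, 0 < d ->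
    U [set n | nrm (be (x n) w - l) < d]); last by exists psi.
  move=> w; apply: (@ultra_lim R U UU (fun n => be (x n) w) (nrm w)) => n.
  by rewrite (le_trans (be_le _ _))// x1 mul1r.
have [d d0 dP] := approx_eigenvectors_far UU psi Uoo x1 xmu.
(* Solving for the values K a (n k) and dividing by - K gives a vector of norm at most 1 / K, and
   |e| / K is at most eta / 2. *)
pose K := 2 * (nrm e + 1) / eta.
have ne0 : 0 < nrm e + 1 by rewrite ltr_wpDl ?nrm_ge0.
have K0 : 0 < K by rewrite divr_gt0// mulr_gt0.
have [||||n [w [w0 aw solve]]] := @interpolating_subsequence R W
    (fun n => be (x n)) psi U UU (fun n => K * a n) d _ _ _ d0 dP _ cW.
- by move=> n b v w; exact: beLr.
- by move=> n v; rewrite (le_trans (be_le _ _))// x1 mul1r.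
- exact: psiP.
- move=> r r0; have [|N NP] := a_small (r / K); first by rewrite divr_gt0.
  apply: filterS (Uoo N) => m /= /NP; rewrite ltr_pdivlMr// mulrC //.
have [|z [z1 zP]] := solve (fun k => (K * a (n k))%:C).
  move=> k; have h := mulr_gt0 K0 (a_gt0 (n k)).
  by rewrite nrmC gtr0_norm.
have [u uP] : exists u : nat -> W,
    forall j k, be (x (n k)) (u j) = (k == j)%:R.
  have [|u uP] := @choice _ _ (fun j v => forall k,
    be (x (n k)) v = (k == j)%:R); last by exists u.
  (* w j is the largest datum allowed at position j; it is divided out afterwards. *)
  move=> j; have [|v [_ vP]] := solve (fun k => (k == j)%:R * (w j)%:C).
    move=> k; have [->|_] := eqVneq k j.
      by rewrite mul1r nrmC gtr0_norm.
    by rewrite mul0r nrm0 ltW.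
  exists ((w j)%:C^-1 *: v) => k; rewrite beZr vP mulrCA mulVf ?mulr1//.
  by rewrite eq_complex/= eqxx andbT gt_eqF.
exists e, (x \o n), (lam \o n), (fun k => (a (n k))%:C), (- K^-1%:C *: z), u.
split=> //.
- split; last by rewrite eq_complex/= eqxx andbT gt_eqF.
  by apply/eqP => e0; have := a0 0%N; rewrite e0 linear0 nrm0 ltxx.
- by move=> k; rewrite Sx.
- move=> k; rewrite beZr zP mulNr -rmorphM/= mulrA mulVf ?mul1r// gt_eqF//.
- rewrite nrmZ nrmN nrmC gtr0_norm ?invr_gt0//.
  apply: (@le_lt_trans _ _ (K^-1 * nrm e)).
    by rewrite ler_wpM2r ?nrm_ge0// ler_piMr// invr_ge0 ltW.
  rewrite /K invf_div mulrAC ltr_pdivrMr ?mulr_gt0//.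
  by have := nrm_ge0 e; nra.
Qed.

End PairingCore.

(** * Half-spaces and rank one perturbations *)

Section Independence.
Context {K : fieldType} {V : lmodType K}.

Definition independent (a : nat -> V) : Prop :=
  forall n (c : 'I_n -> K), lincomb (fun i : 'I_n => a i) c = 0 ->
    forall i, c i = 0.

Lemma left_kernel m n (M : 'M[K]_(m, n)) : (n < m)%N ->
  exists2 u : 'rV[K]_m, u != 0 & u *m M = 0.
Proof.
move=> nm; exists (nz_row (kermx M)); last first.
  by apply/sub_kermxP; exact: nz_row_sub.
rewrite nz_row_eq0 kermx_eq0 /row_free; apply: contraTneq nm => <-.
by rewrite -leqNgt rank_leq_col.
Qed.

Lemma independent_not_spanned (a : nat -> V) n (v : 'I_n -> V) :
  independent a -> ~ (forall k, exists c, a k = lincomb v c).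
Proof.
move=> ia /choice[C CP].
have [u /eqP u0 uM] := left_kernel (\matrix_(i < n.+1, j < n) C i j) (ltnSn n).
apply: u0; apply/rowP => i; rewrite mxE.
apply: (ia _ (fun i => u 0 i)) => {i}; rewrite /lincomb.
under eq_bigr => i _ do rewrite CP /lincomb scaler_sumr.
rewrite exchange_big big1// => j _.
under eq_bigr do rewrite scalerA.
rewrite -scaler_suml [X in X *: _](_ : _ = 0) ?scale0r//.
have /rowP/(_ j) := uM; rewrite !mxE => h; rewrite -[RHS]h.
by apply: eq_bigr => i _; rewrite mxE.
Qed.

Lemma independent_infinite_dim (Y : set V) (a : nat -> V) :
  (forall k, Y (a k)) -> independent a -> ~ finite_dim Y.
Proof.
move=> Ya ia [n [v [_ YE]]]; apply: (independent_not_spanned (v := v) ia) => k.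
by have := Ya k; rewrite YE => -[c _ <-]; exists c.
Qed.

(** A functional vanishing on Y is determined by its values on the n vectors v i, so n + 1 of them
    are dependent. *)
Lemma independent_infinite_codim (Y : set V) (f : nat -> V -> K) :
    (forall k a x y, f k (a *: x + y) = a * f k x + f k y) ->
    (forall k y, Y y -> f k y = 0) ->
    (forall n (c : 'I_n -> K), (forall x, \sum_(i < n) c i * f i x = 0) ->
      forall i, c i = 0) ->
  ~ finite_codim Y.
Proof.
move=> fL fY fI [n [v [_ vY]]].
have f0 k : f k 0 = 0.
  by apply: (addrI (f k 0)); have := fL k 1 0 0; rewrite scale1r mul1r !addr0.
have fs k (c : 'I_n -> K) : f k (lincomb v c) = \sum_(j < n) c j * f k (v j).
  rewrite /lincomb; apply: (big_rec2 (fun x y => f k x = y)); first exact: f0.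
  by move=> j y x _ <-; rewrite fL.
have [u /eqP u0 uM] :=
  left_kernel (\matrix_(i < n.+1, j < n) f i (v j)) (ltnSn n).
apply: u0; apply/rowP => i; rewrite mxE.
apply: (fI _ (fun i => u 0 i)) => {i} x.
have [c Yc] := vY x.
have fx k : f k x = \sum_(j < n) c j * f k (v j).
  rewrite -fs; have := fL k (-1) (lincomb v c) x.
  rewrite scaleN1r addrC (fY _ _ Yc) mulN1r addrC => /esym/eqP.
  by rewrite subr_eq0 => /eqP.
under eq_bigr => i _ do rewrite fx mulr_sumr.
rewrite exchange_big big1// => j _.
under eq_bigr do rewrite mulrCA.
rewrite -mulr_sumr [X in _ * X](_ : _ = 0) ?mulr0//.
have /rowP/(_ j) := uM; rewrite !mxE => h; rewrite -[RHS]h.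
by apply: eq_bigr => i _; rewrite mxE.
Qed.

Lemma biorthogonal_free n (x : 'I_n -> V) (f : 'I_n -> V -> K) :
    (forall k b y z, f k (b *: y + z) = b * f k y + f k z) ->
    (forall i j, f j (x i) = (i == j)%:R) ->
  forall c, lincomb x c = 0 -> forall i, c i = 0.
Proof.
move=> fL fx c cx i.
have f0 : f i 0 = 0.
  by apply: (addrI (f i 0)); have := fL i 1 0 0; rewrite scale1r mul1r !addr0.
have : f i (lincomb x c) = \sum_(j < n) c j * f i (x j).
  rewrite /lincomb; apply: (big_rec2 (fun y z => f i y = z)); first exact: f0.
  by move=> j y z _ <-; rewrite fL.
rewrite cx f0 (bigD1 i)//= fx eqxx mulr1 big1 ?addr0 => [/esym//|j ji].
by rewrite fx (negbTE ji) mulr0.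
Qed.

Lemma biorthogonal_independent (a : nat -> V) (f : nat -> V -> K) :
    (forall k b x y, f k (b *: x + y) = b * f k x + f k y) ->
    (forall j k, f j (a k) = (k == j)%:R) -> independent a.
Proof.
move=> fL fa n; exact: (biorthogonal_free (f := fun i : 'I_n => f i)).
Qed.

End Independence.

(** * Rank one operators *)

Section RankOne.
Context {R : realType} {X : normedModType R[i]}.

Lemma bop_sumE (Y : normedModType R[i]) (I : Type) (s : seq I) (P : pred I)
    (F : I -> bop X Y) x :
  (\sum_(i <- s | P i) F i) x = \sum_(i <- s | P i) F i x.
Proof. exact: (big_morph (fun f : bop X Y => f x)). Qed.

Lemma dual_linear (f : dual X) a x y : f (a *: x + y) = a * f x + f y.
Proof. exact: linearP. Qed.

Lemma rank1_exists (f : dual X) (c : X) :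
  exists F : bop X X, forall x, F x = (f x : R[i]) *: c.
Proof.
apply: (@make_bop _ _ _ _ (nrm f * nrm c)) => [a x y|x].
  by rewrite dual_linear scalerDl scalerA.
by rewrite nrmZ mulrAC ler_wpM2r ?nrm_ge0//; exact: (bop_le f x).
Qed.

Definition rank1 (f : dual X) (c : X) : bop X X := projT1 (cid (rank1_exists f c)).

Lemma rank1E f c x : rank1 f c x = (f x : R[i]) *: c.
Proof. exact: (projT2 (cid (rank1_exists f c))). Qed.

Lemma nrm_rank1 f c : nrm (rank1 f c) <= nrm f * nrm c.
Proof.
apply: bop_nrm_le => [|x]; first by rewrite mulr_ge0 ?nrm_ge0.
by rewrite rank1E nrmZ mulrAC ler_wpM2r ?nrm_ge0//; exact: (bop_le f x).
Qed.

Lemma rank1_has_rank f c : f != 0 -> c != 0 -> has_rank 1 (rank1 f c).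
Proof.
move=> f0 c0; have [x fx] : exists x, f x != 0.
  apply: contrapT => h; case/eqP: f0; apply: bopP => x.
  by apply/eqP; rewrite -[_ == _]negbK; apply/negP => fx; apply: h; exists x.
exists (fun=> c); split.
  move=> d; rewrite /lincomb big_ord1 => /eqP; rewrite scaler_eq0 (negbTE c0).
  by rewrite orbF => /eqP d0 i; rewrite ord1.
apply/seteqP; split=> _ [y _ <-].
  by exists (fun=> f y) => //; rewrite /lincomb big_ord1 rank1E.
exists ((y ord0 / f x) *: x) => //.
rewrite rank1E linearZ/= /lincomb big_ord1 [_ *: f x](_ : _ = y ord0)//.
by rewrite -[LHS]/(_ * _) divfK.
Qed.

End RankOne.

(** * Half-spaces as annihilators *)

Section AnnihilatorHalfSpace.
Context {R : realType} {X : normedModType R[i]}.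

Lemma bop_closed_kernel (f : dual X) : closed [set x | f x = 0].
Proof.
have cf : continuous f by apply/bounded_operatorP/bop_bounded.
apply: (@closed_comp _ _ f [set x | x = 0]) => [x _|]; first exact: cf.
apply: (@accessible_closed_set1 R[i]^o); apply: hausdorff_accessible.
exact: norm_hausdorff.
Qed.

(** An annihilator is closed for free; vectors in it account for the infinite dimension, functionals
    in [G] for the infinite codimension. *)
Lemma annihilator_half_space (S : bop X X) (G : set (dual X))
    (a : nat -> X) (f : nat -> dual X) :
    (forall g y, G g -> (forall h, G h -> h y = 0) -> g (S y) = 0) ->
    (forall g k, G g -> g (a k) = 0) -> independent a ->
    (forall k, G (f k)) -> independent f ->
  has_invariant_half_space S.
Proof.
move=> GS Ga ia Gf indf; exists [set y | forall g, G g -> g y = 0]; last first.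
  by move=> _ [y Yy <-] g Gg; exact: GS.
split.
- split=> [g _|b x y Yx Yy g Gg]; first exact: linear0.
  by rewrite dual_linear Yx// Yy// mulr0 addr0.
- rewrite [X in closed X](_ : _ = \bigcap_(g in G) [set y | g y = 0]).
    by apply: closed_bigI => g _; exact: bop_closed_kernel.
  by apply/seteqP; split=> y h g; exact: h.
- by apply: (independent_infinite_dim (a := a)) => // k g; exact: Ga.
- apply: (independent_infinite_codim (f := fun k x => f k x)).
  + by move=> k b x y; exact: dual_linear.
  + by move=> k y /(_ _ (Gf k)).
  + move=> n c cf; apply: indf; apply: bopP => x.
    by rewrite /lincomb bop_sumE -[RHS](cf x).
Qed.

(** The half-space is the closed span of the even eigenvectors, written as the annihilator of their
    annihilator. Independence is assumed apart from the vanishing of the off-diagonal values because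
    an eigenvector and a coeigenvector for the same eigenvalue may annihilate each other. *)
Lemma eigenvectors_half_space (S : bop X X) (x : nat -> X) (nu : nat -> R[i])
    (f : nat -> dual X) :
    (forall k, S (x k) = nu k *: x k) ->
    (forall j k, j != k -> f j (x k) = 0) ->
    independent (fun k => x k.*2) -> independent (fun k => f k.*2.+1) ->
  has_invariant_half_space S.
Proof.
move=> Sx fx ix indf.
apply: (@annihilator_half_space S [set g | forall k, g (x k.*2) = 0]
  (fun k => x k.*2) (fun k => f k.*2.+1)) => //.
- move=> g y Gg Yy; apply: (Yy (adjoint S g)) => k.
  by rewrite /= Sx linearZ/= Gg scaler0.
- by move=> k j; apply: fx; apply/eqP => /(congr1 odd); rewrite /= !odd_double.
Qed.

(** Here the half-space is the common kernel of the even coeigenvectors, and the odd u k lie in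
    it. *)
Lemma coeigenvectors_half_space (S : bop X X) (x : nat -> dual X)
    (nu : nat -> R[i]) (u : nat -> X) :
    (forall k, adjoint S (x k) = nu k *: x k) ->
    (forall j k, j != k -> x j (u k) = 0) ->
    independent (fun k => x k.*2) -> independent (fun k => u k.*2.+1) ->
  has_invariant_half_space S.
Proof.
move=> Sx xu ix iu.
apply: (@annihilator_half_space S [set x k.*2 | k in setT]
  (fun k => u k.*2.+1) (fun k => x k.*2)) => //.
- move=> _ y [k _ <-] Yy; rewrite -[LHS]/(adjoint S (x k.*2) y) Sx bopZE Yy ?scaler0//.
- move=> _ j [k _ <-]; apply: xu.
  by apply/eqP => /(congr1 odd); rewrite /= !odd_double.
Qed.

Lemma biorthogonal_eigenvectors_half_space (S : bop X X) (x : nat -> X)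
    (nu : nat -> R[i]) (f : nat -> dual X) :
    (forall k, S (x k) = nu k *: x k) ->
    (forall j k, (f j (x k) : R[i]) = (k == j)%:R) ->
  has_invariant_half_space S.
Proof.
move=> Sx biorth; apply: (@eigenvectors_half_space _ x nu f) => //.
- by move=> j k jk; rewrite biorth eq_sym (negbTE jk).
- apply: (biorthogonal_independent (f := fun k y => f k.*2 y)).
    by move=> k b y t; exact: dual_linear.
  by move=> j k; rewrite biorth (inj_eq double_inj).
- apply: (biorthogonal_independent (f := fun k (h : dual X) => h (x k.*2.+1))).
    by move=> k b y t.
  by move=> j k; rewrite biorth eqSS (inj_eq double_inj) eq_sym.
Qed.

Lemma biorthogonal_coeigenvectors_half_space (S : bop X X) (x : nat -> dual X)
    (nu : nat -> R[i]) (u : nat -> X) :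
    (forall k, adjoint S (x k) = nu k *: x k) ->
    (forall j k, (x k (u j) : R[i]) = (k == j)%:R) ->
  has_invariant_half_space S.
Proof.
move=> Sx biorth; apply: (@coeigenvectors_half_space _ x nu u) => //.
- by move=> j k jk; rewrite biorth (negbTE jk).
- apply: (biorthogonal_independent (f := fun k (h : dual X) => h (u k.*2))).
    by move=> k b y t.
  by move=> j k; rewrite biorth (inj_eq double_inj).
- apply: (biorthogonal_independent (f := fun k y => x k.*2.+1 y)).
    by move=> k b y t; exact: dual_linear.
  by move=> j k; rewrite biorth eqSS (inj_eq double_inj) eq_sym.
Qed.

End AnnihilatorHalfSpace.

(** * Small rank one perturbations *)

Section RankOnePerturbation.
Context {R : realType}.

(** The growth 8^n is what [unbounded_orbit] consumes. An adjoint can have this property for two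
    reasons: its own spectrum, or the transposed resolvents of the original operator. *)
Definition resolvent_blowup (B : normedModType R[i]) (S : bop B B) (mu : R[i]) :=
  exists (lam : nat -> R[i]) (Rs : nat -> bop B B),
    [/\ forall n b, S (Rs n b) = lam n *: Rs n b + b,
        forall n, nrm (lam n - mu) <= 2^-1 ^+ n
      & forall n, 8 ^+ n <= nrm (Rs n)].

Context {X : completeNormedModType R[i]}.

Lemma dual_complete : seq_complete (dual X).
Proof.
have h : seq_complete R[i]^o := @complex_seq_complete R.
exact: bop_seq_complete h.
Qed.

Lemma norming_le (x : X) (M : R) : 0 <= M ->
  (forall f : dual X, nrm f <= 1 -> nrm (f x) <= M) -> nrm x <= M.
Proof.
move=> M0 h; have [f [fn fx]] := norming_functional x.
by rewrite -fx; apply: h; apply: bop_nrm_le => // y; rewrite mul1r.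
Qed.

Lemma dual_nrm_le (f : dual X) (M : R) : 0 <= M ->
  (forall x, nrm x <= 1 -> nrm (f x) <= M) -> nrm f <= M.
Proof.
move=> M0 h; rewrite nrm_bop; apply: opnorm_le => x x1.
by rewrite -nrmE lecR h// nrm_le.
Qed.

Lemma rank_one_perturbation (S : bop X X) (mu : R[i]) (eps : R) :
    resolvent_blowup S mu -> (forall b, S b = mu *: b -> b = 0) -> 0 < eps ->
  exists (f : dual X) (c : X), [/\ f != 0, c != 0, nrm (rank1 f c) < eps &
    has_invariant_half_space (S + rank1 f c)].
Proof.
move=> [lam [Rs [RsP lamP Rs8]]] mu_inj eps0.
have [||||e [x [nu [g [z [u [[e0 g0] Sx xz xu ze]]]]]]] :=
  @resolvent_biorthogonal R X (dual X) (fun b w => w b) _ _ _ _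
    (complete_seq_complete (X := X)) dual_complete S mu lam Rs RsP lamP Rs8
    mu_inj eps eps0.
- by move=> w a b c; exact: dual_linear.
- by [].
- by move=> b w; rewrite mulrC; exact: (bop_le w b).
- exact: norming_le.
have biorth j k : (u j (x k) : R[i]) = (k == j)%:R by exact: xu.
exists z, e; split=> //.
- by apply: contraNneq g0 => z0; rewrite -[g 0%N]opprK -xz z0 oppr0.
- exact: le_lt_trans (nrm_rank1 _ _) ze.
apply: (@biorthogonal_eigenvectors_half_space _ _ _ x nu u) => // k.
by rewrite bopDE rank1E xz Sx scaleNr addrK.
Qed.

Lemma corank_one_perturbation (S : bop X X) (mu : R[i]) (eps : R) :
    resolvent_blowup (adjoint S) mu ->
    (forall b, adjoint S b = mu *: b -> b = 0) -> 0 < eps ->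
  exists (f : dual X) (c : X), [/\ f != 0, c != 0, nrm (rank1 f c) < eps &
    has_invariant_half_space (S + rank1 f c)].
Proof.
move=> [lam [Rs [RsP lamP Rs8]]] mu_inj eps0.
have [||||e [x [nu [g [z [u [[e0 g0] Sx xz xu ze]]]]]]] :=
  @resolvent_biorthogonal R (dual X) X (fun b w => b w) _ _ _ _
    dual_complete (complete_seq_complete (X := X)) (adjoint S) mu lam Rs
    RsP lamP Rs8 mu_inj eps eps0.
- by [].
- by move=> b a v w; exact: dual_linear.
- by move=> b w; exact: (bop_le b w).
- exact: dual_nrm_le.
have biorth j k : (x k (u j) : R[i]) = (k == j)%:R by exact: xu.
exists e, z; split=> //.
- apply: contraNneq g0 => z0; rewrite -[g 0%N]opprK -xz z0 linear0 oppr0//.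
- by rewrite mulrC in ze; exact: le_lt_trans (nrm_rank1 _ _) ze.
apply: (@biorthogonal_coeigenvectors_half_space _ _ _ x nu u) => // k.
apply: bopP => y /=; rewrite linearD rank1E linearZ/= xz.
have /(congr1 (fun h : dual X => h y)) /= -> := Sx k.
by rewrite scalerN -[g k *: e y]mulrC addrK.
Qed.

End RankOnePerturbation.

(** * Inverses and spectra *)

Section Inverses.
Context {R : realType} {V : normedModType R[i]}.
Implicit Types A B E S : bop V V.

Definition spectral_shift S (a : R[i]) : bop V V := S - a *: (1 : bop V V).

Lemma spectral_shiftE S a x : spectral_shift S a x = S x - a *: x.
Proof. by []. Qed.

Definition inverse_of S B : Prop := B * S = 1 /\ S * B = 1.

Lemma invertibleP S : invertible S <-> exists B, inverse_of S B.
Proof. by []. Qed.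

Lemma inverse_ofM S S' B B' :
  inverse_of S B -> inverse_of S' B' -> inverse_of (S * S') (B' * B).
Proof.
move=> [BS SB] [BS' SB']; split.
  by rewrite mulrA -(mulrA B') BS mulr1.
by rewrite mulrA -(mulrA S) SB' mulr1.
Qed.

Lemma invertibleM S S' : invertible S -> invertible S' -> invertible (S * S').
Proof. by move=> [B SB] [B' SB']; exists (B' * B); exact: inverse_ofM. Qed.

Lemma invertible1 : invertible (1 : bop V V).
Proof. by exists 1; split; exact: mulr1. Qed.

(** The lower bound replaces the open mapping theorem and keeps the norm of the inverse explicit. *)
Lemma bijective_inverse S (c : R) : 0 < c -> (forall y, exists x, S x = y) ->
  (forall x, c * nrm x <= nrm (S x)) ->
  exists2 B, inverse_of S B & nrm B <= c^-1.
Proof.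
move=> c0 Ssurj Sc; have [f fP] := choice Ssurj.
have Sinj x y : S x = S y -> x = y.
  move=> Sxy; apply/eqP; rewrite -subr_eq0; apply/eqP/nrm0_eq0/eqP.
  rewrite eq_le nrm_ge0 andbT -(pmulr_rle0 _ c0) (le_trans (Sc _))//.
  by rewrite linearB Sxy subrr nrm0.
have fc y : nrm (f y) <= c^-1 * nrm y.
  by rewrite mulrC ler_pdivlMr// mulrC -{2}(fP y).
have [|F Ff] := make_bop _ fc.
  by move=> a x y; apply: Sinj; rewrite linearP !fP.
exists F; last first.
  apply: bop_nrm_le => [|y]; last by rewrite Ff.
  by rewrite invr_ge0 ltW.
by split; apply: bopP => x; rewrite bopME bop1E Ff ?fP//; apply: Sinj; rewrite fP.
Qed.

Lemma nrm_scalar (a : R[i]) : nrm (a *: (1 : bop V V)) <= nrm a.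
Proof. by rewrite nrmZ ler_piMr ?nrm_ge0// nrm_one. Qed.

Hypothesis cV : seq_complete V.

Lemma neumann_inverse A : nrm A <= 2^-1 ->
  exists2 B, inverse_of (1 - A) B & nrm B <= 2.
Proof.
move=> A2; have Ax x : nrm (A x) <= 2^-1 * nrm x.
  by rewrite (le_trans (bop_le _ _))// ler_wpM2r ?nrm_ge0.
have [|||B BP B2] := @bijective_inverse (1 - A) 2^-1; last first.
- by exists B => //; rewrite -[leRHS]invrK.
- move=> x; rewrite bopDE bopNE bop1E; have := nrm_rev x (A x).
  by have := Ax x; lra.
(* Surjectivity by iterating the contraction that sends u to y + A u, from 0. *)
- move=> y; pose u := fix u n := if n is n'.+1 then y + A (u n') else 0.
  have [|l [ul _]] := geometric_limit (u := u) (eta := 2 * nrm y) cV.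
    elim=> [|n IH]; first by rewrite /= linear0 !addr0 subr0 expr1; lra.
    have -> : u n.+2 - u n.+1 = A (u n.+1 - u n).
      by rewrite /= linearB addrC opprD addrACA addNr add0r addrC.
    rewrite (le_trans (Ax _))// half_exprS mulrA [leRHS]mulrC ler_wpM2l//.
    by rewrite invr_ge0.
  exists l; apply/eqP; rewrite -subr_eq0; apply/eqP/nrm0_eq0/eqP.
  rewrite eq_le nrm_ge0 andbT; apply/ler_addgt0Pl => e e0; rewrite addr0.
  have [|N NP] := ul (e / 2); first by rewrite divr_gt0.
  have -> : (1 - A) l - y = A (u N - l) - (u N.+1 - l).
    rewrite bopDE bopNE bop1E /= linearB; apply/esym.
    by rewrite opprB addrC addrA opprD addrA subrK addrAC.
  have := nrmB (A (u N - l)) (u N.+1 - l); have := Ax (u N - l).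
  by have := NP _ (leqnn N); have := NP _ (leqnSn N); lra.
- by rewrite invr_gt0.
Qed.

Lemma inverse_near S B E : inverse_of S B -> nrm B * nrm E <= 2^-1 ->
  exists2 B', inverse_of (S - E) B' & nrm B' <= 2 * nrm B.
Proof.
move=> SB BE; have [|C CP C2] := @neumann_inverse (B * E).
  by rewrite (le_trans (nrm_comp _ _)).
exists (C * B).
  have -> : S - E = S * (1 - B * E).
    by rewrite mulrBr mulr1 mulrA SB.2 mul1r.
  exact: inverse_ofM.
by rewrite (le_trans (nrm_comp _ _))// ler_wpM2r ?nrm_ge0.
Qed.

Lemma spectral_shift_shift S (a b : R[i]) :
  spectral_shift S b = spectral_shift S a - (b - a) *: (1 : bop V V).
Proof. by rewrite /spectral_shift scalerBl opprB addrA subrK. Qed.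

Lemma regular_open S (lam : R[i]) : invertible (spectral_shift S lam) ->
  exists2 d : R, 0 < d &
    forall mu, nrm (mu - lam) < d -> invertible (spectral_shift S mu).
Proof.
move=> [B SB]; have B1 : 0 < nrm B + 1 by rewrite ltr_wpDl ?nrm_ge0.
exists (2^-1 / (nrm B + 1)); first by rewrite divr_gt0// invr_gt0.
move=> mu mud; rewrite (spectral_shift_shift S lam mu).
have [|B' ? _] := inverse_near (E := (mu - lam) *: (1 : bop V V)) SB; last by exists B'.
rewrite ltr_pdivlMr// in mud.
apply: le_trans (ler_wpM2l (nrm_ge0 _) (nrm_scalar _)) _.
by have := nrm_ge0 (mu - lam); have := nrm_ge0 B; nra.
Qed.

Lemma regular_large S (lam : R[i]) : 2 * nrm S < nrm lam ->
  invertible (spectral_shift S lam).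
Proof.
move=> Sl; have l0 : 0 < nrm lam by have := nrm_ge0 S; lra.
have ln0 : lam != 0 by rewrite -nrm_gt0.
have [|B [B1 B2] _] := @neumann_inverse (lam^-1 *: S).
  by rewrite nrmZ nrmV mulrC ler_pdivrMr//; lra.
have SE : spectral_shift S lam = - lam *: (1 - lam^-1 *: S).
  by rewrite /spectral_shift scalerBr !scaleNr opprK scalerA mulfV// scale1r addrC.
have nl : - lam != 0 by rewrite oppr_eq0.
apply/invertibleP; exists (- lam^-1 *: B); rewrite SE; split.
  by rewrite -bopZAl -bopZAr scalerA B1 mulrNN mulVf// scale1r.
by rewrite -bopZAl -bopZAr scalerA B2 mulrNN mulfV// scale1r.
Qed.

(** Membership in the closure of the resolvent set; for a spectral point, being on the boundary. It
    is kept apart because a perturbation has to preserve it before it is known whether mu stays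
    spectral. *)
Definition accessible S (mu : R[i]) : Prop := forall d : R, 0 < d ->
  exists2 lam, nrm (lam - mu) < d & invertible (spectral_shift S lam).

Lemma accessible_resolvents S mu :
  accessible S mu -> ~ invertible (spectral_shift S mu) ->
  exists (lam : nat -> R[i]) (Rs : nat -> bop V V), forall n,
    [/\ inverse_of (spectral_shift S (lam n)) (Rs n), nrm (lam n - mu) <= 2^-1 ^+ n
      & 8 ^+ n <= nrm (Rs n)].
Proof.
move=> acc nmu.
have h n : exists p : R[i] * bop V V, [/\ inverse_of (spectral_shift S p.1) p.2,
    nrm (p.1 - mu) <= 2^-1 ^+ n & 8 ^+ n <= nrm p.2].
  have e8 : 0 < (8^-1 : R) ^+ n by rewrite exprn_gt0// invr_gt0.
  (* At distance below 8^-n / 2, a resolvent of norm less than 8^n would extend invertibility to mu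
     by a Neumann series. *)
  have [|lam lm [B SB]] := acc (8^-1 ^+ n / 2); first by rewrite divr_gt0.
  exists (lam, B); split=> //=.
    apply: (le_trans (ltW lm)); apply: (@le_trans _ _ (8^-1 ^+ n)); first lra.
    by rewrite lerXn2r ?nnegrE ?invr_ge0// lef_pV2 ?posrE// ler_nat.
  rewrite leNgt; apply/negP => B8; apply: nmu.
  rewrite (spectral_shift_shift S lam mu).
  have [|B' ? _] := inverse_near (E := (mu - lam) *: (1 : bop V V)) SB;
    last by exists B'.
  apply: le_trans (ler_wpM2l (nrm_ge0 _) (nrm_scalar _)) _.
  rewrite nrm_sub; apply: (@le_trans _ _ (8 ^+ n * (8^-1 ^+ n / 2))).
    by apply: ler_pM; rewrite ?nrm_ge0 ?ltW.
  by rewrite exprVn mulrA mulfV ?mul1r// gt_eqF// exprn_gt0.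
have [p pP] := choice h.
by exists (fst \o p), (snd \o p).
Qed.

Lemma resolvent_eq S (lam : R[i]) B b : inverse_of (spectral_shift S lam) B ->
  S (B b) = lam *: B b + b.
Proof.
move=> [_ /(congr1 (fun F : bop V V => F b))].
rewrite bopME spectral_shiftE bop1E => /eqP.
by rewrite subr_eq addrC => /eqP.
Qed.

Lemma accessible_blowup S mu : accessible S mu -> ~ invertible (spectral_shift S mu) ->
  resolvent_blowup S mu.
Proof.
move=> acc nmu; have [lam [Rs RsP]] := accessible_resolvents acc nmu.
exists lam, Rs; split=> [n b|n|n]; have [h1 h2 h3] := RsP n => //.
exact: resolvent_eq.
Qed.

End Inverses.

Section AdjointResolvent.
Context {R : realType} {X : completeNormedModType R[i]}.

Lemma adjoint_nrm_ge (S : bop X X) : nrm S <= nrm (adjoint S).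
Proof.
apply: bop_nrm_le => [|x]; first exact: nrm_ge0.
have [f [fn fx]] := norming_functional (S x).
have f1 : nrm f <= 1 by apply: bop_nrm_le => // y; rewrite mul1r.
rewrite -fx -[f (S x)]/(adjoint S f x).
apply: le_trans (bop_le (adjoint S f) x) _; rewrite ler_wpM2r ?nrm_ge0//.
apply: le_trans (bop_le (adjoint S) f) _.
by rewrite ler_piMr ?nrm_ge0.
Qed.

(** A left inverse of S - lam transposes to a right inverse for the adjoint, and its norm does not
    drop. *)
Lemma accessible_adjoint_blowup (S : bop X X) (mu : R[i]) :
  accessible S mu -> ~ invertible (spectral_shift S mu) ->
  resolvent_blowup (adjoint S) mu.
Proof.
move=> acc nmu.
have [lam [Rs RsP]] := accessible_resolvents (complete_seq_complete (X := X)) acc nmu.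
exists lam, (fun n => adjoint (Rs n)).
split=> [n b|n|n]; have [[h1 _] h2 h3] := RsP n => //.
  apply: bopP => x /=; rewrite -linearZ -linearD/=; congr (b _).
  have /(congr1 (fun F : bop X X => F x)) := h1.
  rewrite bopME spectral_shiftE bop1E linearB linearZ/= => /eqP.
  by rewrite subr_eq addrC => /eqP.
by rewrite (le_trans h3)// adjoint_nrm_ge.
Qed.

End AdjointResolvent.

(** * The boundary of the spectrum *)

Section SpectrumTopology.
Context {R : realType} {V : normedModType R[i]}.
Hypothesis cV : seq_complete V.
Implicit Types S : bop V V.

Lemma nbhs_nrmP (mu : R[i]^o) (A : set R[i]^o) :
  nbhs mu A <-> exists2 d : R, 0 < d & forall lam : R[i], nrm (lam - mu) < d -> A lam.
Proof.
split=> [/nbhs_ballP[e /= e0 eA]|[d d0 dA]].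
  have eE : e = (complex.Re e)%:C by rewrite RRe_real// gtr0_real.
  exists (complex.Re e); first by rewrite -ltcR -eE.
  move=> lam lm; apply: eA; rewrite -ball_normE /ball_/= eE -nrmE ltcR.
  by rewrite nrm_sub.
apply/nbhs_ballP; exists d%:C => /=; first by rewrite ltcR.
move=> lam; rewrite -ball_normE /ball_/= -nrmE ltcR => lm.
by apply: dA; rewrite nrm_sub.
Qed.

Lemma boundary_spectrumP S (mu : R[i]^o) :
  boundary (spectrum S) mu <-> ~ invertible (spectral_shift S mu) /\ accessible S mu.
Proof.
split=> [[cl ni]|[ninv acc]].
  split.
    move=> /(regular_open cV)[d d0 dP].
    have [lam [/= slam]] := cl _ ((nbhs_nrmP _ [set lam | nrm (lam - mu) < d]).2
      (ex_intro2 _ _ d d0 (fun _ => id))).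
    by move=> /dP.
  move=> d d0; apply: contrapT => h; apply: ni; apply/nbhs_nrmP.
  by exists d => // lam lm /= inv; apply: h; exists lam.
split; first exact: subset_closure.
by move=> /nbhs_nrmP[d d0 dP]; have [lam /dP] := acc d d0.
Qed.

End SpectrumTopology.

(** * Finite rank operators *)

Section BiorthogonalDichotomy.
Context {K : fieldType} {A B : lmodType K} (be : A -> B -> K).
Hypothesis beLl : forall b a x y, be (a *: x + y) b = a * be x b + be y b.
Hypothesis beLr : forall x a b c, be x (a *: b + c) = a * be x b + be x c.

Let be0l b : be 0 b = 0.
Proof.
by apply: (addrI (be 0 b)); have := beLl b 1 0 0; rewrite scale1r mul1r !addr0.
Qed.

Let be0r x : be x 0 = 0.
Proof.
by apply: (addrI (be x 0)); have := beLr x 1 0 0; rewrite scale1r mul1r !addr0.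
Qed.

Let beBl x y b : be (x - y) b = be x b - be y b.
Proof.
by have := beLl b (-1) y x; rewrite scaleN1r mulN1r addrC => ->; rewrite addrC.
Qed.

Let beBr x b c : be x (b - c) = be x b - be x c.
Proof.
by have := beLr x (-1) c b; rewrite scaleN1r mulN1r addrC => ->; rewrite addrC.
Qed.

Let beZr x a b : be x (a *: b) = a * be x b.
Proof. by have := beLr x a b 0; rewrite be0r !addr0. Qed.

Let be_suml n (c : 'I_n -> K) (x : 'I_n -> A) b :
  be (\sum_(i < n) c i *: x i) b = \sum_(i < n) c i * be (x i) b.
Proof.
apply: (big_rec2 (fun x y => be x b = y)); first exact: be0l.
by move=> j y t _ <-; rewrite beLl.
Qed.

Let be_sumr n (c : 'I_n -> K) (x : 'I_n -> B) b :
  be b (\sum_(i < n) c i *: x i) = \sum_(i < n) c i * be b (x i).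
Proof.
apply: (big_rec2 (fun x y => be b x = y)); first exact: be0r.
by move=> j y t _ <-; rewrite beLr.
Qed.

(* Greedy Gram-Schmidt. *)
Lemma biorthogonal_dichotomy (Y : set A) : Defs.subspace Y ->
    (forall a, Y a -> a != 0 -> exists b, be a b != 0) ->
  (exists (x : nat -> A) (f : nat -> B), (forall k, Y (x k)) /\
     forall j k, be (x k) (f j) = (k == j)%:R) \/
  (exists n (x : 'I_n -> A) (f : 'I_n -> B), [/\ forall i, Y (x i),
     forall i j, be (x i) (f j) = (i == j)%:R &
     forall a, Y a -> a = \sum_(i < n) be a (f i) *: x i]).
Proof.
move=> [Y0 YL] nd; pose d : A * B := (0, 0).
pose valid (s : seq (A * B)) := forall i, (i < size s)%N ->
  Y (nth d s i).1 /\ forall j, (j < size s)%N ->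
    be (nth d s i).1 (nth d s j).2 = (i == j)%:R.
have [ext|] := pselect (forall s, valid s -> exists p, valid (rcons s p)).
  left; have [//|p pP] := @seq_choice _ valid _ ext.
  have pn i n : (i < n)%N -> nth d (mkseq p n) i = p i by exact: nth_mkseq.
  exists (fst \o p), (snd \o p); split=> [k|j k] /=.
    have [] := pP k.+1 k; first by rewrite size_mkseq.
    by rewrite pn.
  have jm : (j < (maxn j k).+1)%N by rewrite ltnS leq_maxl.
  have km : (k < (maxn j k).+1)%N by rewrite ltnS leq_maxr.
  have [|_ /(_ j)] := pP (maxn j k).+1 k; first by rewrite size_mkseq.
  by rewrite size_mkseq !pn//; apply.
move=> /existsNP[s /not_implyP[sv next]]; right.
pose x (i : 'I_(size s)) := (nth d s i).1.
pose f (i : 'I_(size s)) := (nth d s i).2.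
have biorth i j : be (x i) (f j) = (i == j)%:R.
  by have [_ ->] := sv _ (ltn_ord i).
exists (size s), x, f; split=> //.
  by move=> i; have [] := sv _ (ltn_ord i).
move=> a Ya; apply: contrapT => na; apply: next.
(* A vector outside the span would extend the system: a' is its part killed by every f j, and b' a
   partner for a' killed by every x j. *)
pose a' := a - \sum_(i < size s) be a (f i) *: x i.
have a'0 : a' != 0 by rewrite subr_eq0; apply/eqP.
have Ya' : Y a'.
  have Ysum : Y (\sum_(i < size s) be a (f i) *: x i).
    apply: big_ind => [//|u v Yu Yv|i _].
      by rewrite -[u]scale1r; exact: YL.
    by rewrite -[_ *: _]addr0; apply: YL => //; have [] := sv _ (ltn_ord i).
  by rewrite /a' addrC -scaleN1r; exact: YL.
have af j : be a' (f j) = 0.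
  rewrite beBl be_suml (bigD1 j)//= biorth eqxx mulr1 big1 ?addr0 ?subrr// => i ij.
  by rewrite biorth (negbTE ij) mulr0.
have [b ab] := nd a' Ya' a'0.
pose b1 := (be a' b)^-1 *: b.
have ab1 : be a' b1 = 1 by rewrite beZr mulVf.
pose b' := b1 - \sum_(i < size s) be (x i) b1 *: f i.
have ab' : be a' b' = 1.
  by rewrite beBr be_sumr ab1 big1 ?subr0// => i _; rewrite af mulr0.
have xb' j : be (x j) b' = 0.
  rewrite beBr be_sumr (bigD1 j)//= biorth eqxx mulr1 big1 ?addr0 ?subrr// => i ij.
  by rewrite biorth eq_sym (negbTE ij) mulr0.
exists (a', b') => i; rewrite size_rcons ltnS !nth_rcons.
have sizeF : (size s < size s)%N = false := ltnn _.
rewrite leq_eqVlt => /predU1P[->|si].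
  rewrite sizeF eqxx /=; split=> // j; rewrite ltnS nth_rcons leq_eqVlt.
  move=> /predU1P[->|sj]; first by rewrite sizeF eqxx ab'.
  by rewrite sj (af (Ordinal sj)) gtn_eqF.
have [Yi bi] := sv i si; rewrite si; split=> // j.
rewrite ltnS nth_rcons leq_eqVlt => /predU1P[->|sj]; last by rewrite sj bi.
by rewrite sizeF eqxx (xb' (Ordinal si)) ltn_eqF.
Qed.

End BiorthogonalDichotomy.

Section FiniteRank.
Context {R : realType} {X : completeNormedModType R[i]}.
Implicit Types (A F G : bop X X) (s : seq (dual X * X)).

Definition rank1s s : bop X X := \sum_(p <- s) rank1 p.1 p.2.

Lemma rank1sE s x : rank1s s x = \sum_(p <- s) (p.1 x : R[i]) *: p.2.
Proof. by rewrite /rank1s bop_sumE; apply: eq_bigr => p _; rewrite rank1E. Qed.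

(** A working form of finite rank, stable under sums and two-sided products with no choice of
    basis. *)
Definition degenerate F : Prop := exists s, F = rank1s s.

Lemma degenerate0 : degenerate 0.
Proof. by exists [::]; rewrite /rank1s big_nil. Qed.

Lemma degenerate_rank1 f c : degenerate (rank1 f c).
Proof. by exists [:: (f, c)]; rewrite /rank1s big_seq1. Qed.

Lemma degenerateD F G : degenerate F -> degenerate G -> degenerate (F + G).
Proof. by move=> [s ->] [t ->]; exists (s ++ t); rewrite /rank1s big_cat. Qed.

Lemma degenerateMl A F : degenerate F -> degenerate (A * F).
Proof.
move=> [s ->]; exists [seq (p.1, A p.2) | p <- s]; apply: bopP => x.
rewrite bopME !rank1sE big_map linear_sum.
by apply: eq_bigr => p _; rewrite linearZ.
Qed.

Lemma degenerateMr A F : degenerate F -> degenerate (F * A).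
Proof.
move=> [s ->]; exists [seq (adjoint A p.1, p.2) | p <- s]; apply: bopP => x.
by rewrite bopME !rank1sE big_map.
Qed.

Lemma degenerateZ (a : R[i]) F : degenerate F -> degenerate (a *: F).
Proof.
by move=> dF; rewrite -[F]mul1r bopZAl; exact: degenerateMl.
Qed.

Lemma dual_separates (a : X) : a != 0 -> exists f : dual X, (f a : R[i]) != 0.
Proof.
move=> a0; have [f [_ fa]] := norming_functional a; exists f.
by rewrite -nrm_gt0 fa nrm_gt0.
Qed.

(** The dichotomy for the range: an infinite biorthogonal family cannot lie in the span of finitely
    many vectors, and the finite alternative provides a basis. *)
Lemma degenerate_finite_rank F : degenerate F -> finite_rank F.
Proof.
move=> [s Fs].
have sY : Defs.subspace (range F).
  split; first by exists 0 => //; rewrite linear0.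
  by move=> a _ _ [x _ <-] [y _ <-]; exists (a *: x + y) => //; rewrite linearP.
have [|||[x [f [xY xf]]]|[n [x [f [xY xf xE]]]]] :=
  @biorthogonal_dichotomy R[i] X (dual X) (fun a f => f a) _ _ _ sY.
- by move=> b a y t; exact: dual_linear.
- by [].
- by move=> a _; exact: dual_separates.
- exfalso; have ix : independent x.
    apply: (biorthogonal_independent (f := fun k y => f k y)) => // k b y t.
    exact: dual_linear.
  apply: (independent_not_spanned
    (v := fun j : 'I_(size s) => (nth (0, 0) s j).2) ix) => k.
  have [y _ <-] := xY k; rewrite Fs rank1sE (big_nth (0, 0)) big_mkord.
  by exists (fun j => (nth (0, 0) s j).1 y : R[i]).
exists n, x; split.
  apply: (biorthogonal_free (f := fun i y => f i y)) => [k b y z|//].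
  exact: dual_linear.
apply/seteqP; split=> [y Fy|_ [c _ <-]]; last first.
  rewrite /lincomb; apply: big_ind => [|y z Yy Yz|i _].
  - by have [] := sY.
  - by rewrite -[y]scale1r; apply: sY.2.
  - by rewrite -[_ *: _]addr0; apply: sY.2 => //; have [] := sY.
by rewrite (xE y Fy); exists (fun i => f i y).
Qed.

Lemma degenerate_kernel F : ~ finite_dim [set: X] -> degenerate F ->
  exists2 x, x != 0 & F x = 0.
Proof.
move=> infX [s ->].
have [||||[x [f [_ xf]]]|[n [x [f [_ xf xE]]]]] :=
  @biorthogonal_dichotomy R[i] X (dual X) (fun a f => f a) _ _ [set: X] _.
- by move=> b a y t; exact: dual_linear.
- by [].
- by [].
- by move=> a _; exact: dual_separates.
- have ix : independent x.
    apply: (biorthogonal_independent (f := fun k y => f k y)) => // k b y t.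
    exact: dual_linear.
  pose M := \matrix_(i < (size s).+1, j < size s) ((nth (0, 0) s j).1 (x i) : R[i]).
  have [u u0 uM] := left_kernel M (ltnSn _).
  exists (lincomb (fun i : 'I_(size s).+1 => x i) (fun i => u 0 i)).
    apply/eqP => xu; case/eqP: u0; apply/rowP => i; rewrite mxE.
    exact: (ix _ (fun i => u 0 i)).
  rewrite rank1sE (big_nth (0, 0)) big_mkord big1// => j _.
  rewrite [X in X *: _](_ : _ = 0) ?scale0r//.
  have /rowP/(_ j) := uM; rewrite !mxE => h; rewrite -[RHS]h.
  rewrite /lincomb linear_sum; apply: eq_bigr => i _; rewrite mxE.
  exact: linearZ.
exfalso; apply: infX; exists n, x; split.
  apply: (biorthogonal_free (f := fun i y => f i y)) => [k b y z|//].
  exact: dual_linear.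
by apply/seteqP; split=> // y _; rewrite (xE y Logic.I); exists (fun i => f i y).
Qed.

End FiniteRank.

(** * Quasinilpotent operators *)

Section Quasinilpotent.
Context {R : realType} {V : normedModType R[i]}.
Hypothesis cV : seq_complete V.
Context (A : bop V V).
Hypothesis A_spec : forall lam : R[i], lam != 0 -> invertible (spectral_shift A lam).

Lemma inverse_unique (S B B' : bop V V) :
  inverse_of S B -> inverse_of S B' -> B = B'.
Proof. by move=> [BS _] [_ SB']; rewrite -[B]mulr1 -SB' mulrA BS mul1r. Qed.

Lemma pencil_inverse (lam : R[i]) :
  exists B, inverse_of (1 - lam *: A) B.
Proof.
have [->|l0] := eqVneq lam 0.
  by rewrite scale0r subr0; exists 1; split; rewrite mulr1.
have [B SB] := A_spec (invr_neq0 l0).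
have -> : 1 - lam *: A = (- lam *: (1 : bop V V)) * spectral_shift A lam^-1.
  rewrite /spectral_shift mulrBr -!bopZAl !mul1r scalerA mulNr mulfV//.
  by rewrite scaleN1r opprK scaleNr addrC.
exists (B * (- lam^-1 *: (1 : bop V V))); apply: inverse_ofM => //.
have nn : (- lam) * (- lam^-1) = 1 by rewrite mulrNN mulfV.
by split; rewrite -bopZAl -bopZAr mulr1 scalerA ?nn ?[_ * - lam]mulrC ?nn scale1r.
Qed.

(** Compactness of the disc through ultralimits: near a limit lam of bad parameters, the Neumann
    series bounds the inverses by 2 |f lam|. *)
Lemma pencil_bounded (f : R[i] -> bop V V) (rho : R) :
    (forall lam, inverse_of (1 - lam *: A) (f lam)) ->
  exists2 K, 0 < K & forall lam, nrm lam <= rho -> nrm (f lam) <= K.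
Proof.
move=> fP; apply: contrapT => h.
have [l lP] : exists l : nat -> R[i], forall n, nrm (l n) <= rho /\
    n.+1%:R < nrm (f (l n)).
  have [|l lP] := @choice _ _ (fun n lam => nrm lam <= rho /\
    n.+1%:R < nrm (f lam)); last by exists l.
  move=> n; apply: contrapT => hn; apply: h; exists n.+1%:R => // lam lr.
  by rewrite leNgt; apply/negP => fl; apply: hn; exists lam.
have [U [UU Uoo]] := free_ultrafilter.
have [|lam lamP] := @ultra_lim R U UU l rho; first by move=> n; have [] := lP n.
pose d := 2^-1 / ((nrm (f lam) + 1) * (nrm A + 1)).
have fp : 0 < nrm (f lam) + 1 by rewrite ltr_wpDl ?nrm_ge0.
have Ap : 0 < nrm A + 1 by rewrite ltr_wpDl ?nrm_ge0.
have d0 : 0 < d by rewrite divr_gt0 ?mulr_gt0// invr_gt0.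
pose N := Num.truncn (2 * nrm (f lam)).
have [n [/= h1 h2]] := ultra_nonempty (filterI (lamP _ d0) (Uoo N)).
have [|B BP B2] :=
    @inverse_near _ _ cV (1 - lam *: A) (f lam) ((l n - lam) *: A) (fP lam).
  rewrite nrmZ mulrCA; move: h1; rewrite /d ltr_pdivlMr ?mulr_gt0// => h1.
  apply: le_trans (ltW h1); rewrite ler_wpM2l ?nrm_ge0//.
  by apply: ler_pM; rewrite ?nrm_ge0// lerDl.
have : B = f (l n).
  apply: inverse_unique (fP (l n)); move: BP.
  by rewrite -addrA -opprD -scalerDl [lam + _]addrC subrK.
move=> BE; rewrite BE in B2; have [_] := lP n.
rewrite ltNge (le_trans B2)// ltW// (lt_le_trans (truncnS_gt _))//.
by rewrite ler_nat.
Qed.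

Lemma square_root_of_minus_one k :
  exists2 w : R[i], w ^+ (2 ^ k) = -1 & nrm w = 1.
Proof.
elim: k => [|k [w wk w1]]; first by exists (-1); rewrite ?expr1// nrmN nrm1.
exists (sqrtC w); first by rewrite expnS exprM sqrtCK.
have : nrm (sqrtC w) ^+ 2 = 1 by rewrite expr2 -nrmM -expr2 sqrtCK.
by move/eqP; rewrite sqrp_eq1 ?nrm_ge0// => /eqP.
Qed.

Lemma exprZ (a : R[i]) (S : bop V V) n : (a *: S) ^+ n = a ^+ n *: S ^+ n.
Proof.
elim: n => [|n IH]; first by rewrite !expr0 scale1r.
by rewrite !exprS IH -bopZAl -bopZAr scalerA.
Qed.

(* Rickart: with [w ^ (2 ^ k) = -1] and [x = (lam A) ^ (2 ^ k)],
   [(1 - x^2)^-1] is the mean of [(1 - x)^-1] and [(1 + x)^-1], which are values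
   at [lam] and [w lam] of the same function; so the modulus of continuity
   of [f] is inherited by all the [M k]. *)
Lemma dyadic_resolvents (rho : R) :
  exists (K L : R) (M : nat -> R[i] -> bop V V), [/\ 0 < K, 0 < L,
    forall k lam, inverse_of (1 - (lam *: A) ^+ (2 ^ k)) (M k lam),
    forall k lam, nrm lam <= rho -> nrm (M k lam) <= K
  & forall k lam mu, nrm lam <= rho -> nrm mu <= rho ->
      nrm (M k lam - M k mu) <= L * nrm (lam - mu)].
Proof.
have [f fP] := choice pencil_inverse.
have [K K0 fK] := pencil_bounded rho fP.
have fL lam mu : nrm lam <= rho -> nrm mu <= rho ->
    nrm (f lam - f mu) <= (K * nrm A * K + 1) * nrm (lam - mu).
  (* The resolvent identity for the pencil. *)
  move=> lr mr; have -> : f lam - f mu = (lam - mu) *: (f lam * A * f mu).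
    have AE : (lam - mu) *: A = (1 - mu *: A) - (1 - lam *: A).
      by rewrite scalerBl [RHS]addrC opprB addrA subrK.
    rewrite bopZAl bopZAr AE mulrBr mulrBl (fP lam).1 mul1r -mulrA (fP mu).2 mulr1 //.
  rewrite nrmZ mulrC ler_wpM2r ?nrm_ge0//.
  rewrite (le_trans (nrm_comp _ _))// ler_wpDr//.
  apply: ler_pM; rewrite ?nrm_ge0 ?fK//.
  by rewrite (le_trans (nrm_comp _ _))// ler_wpM2r ?nrm_ge0 ?fK.
have [w wP] : exists w : nat -> R[i], forall k,
    w k ^+ (2 ^ k) = -1 /\ nrm (w k) = 1.
  have [|w wP] := @choice _ _ (fun k (w : R[i]) => w ^+ (2 ^ k) = -1 /\ nrm w = 1);
    last by exists w.
  by move=> k; have [w] := square_root_of_minus_one k; exists w.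
pose M := fix M k lam := if k is k'.+1
  then 2^-1 *: (M k' lam + M k' (w k' * lam)) else f lam.
have wl k lam : nrm (w k * lam) = nrm lam by rewrite nrmM (wP k).2 mul1r.
have half (B : bop V V) : 2^-1 *: (B + B) = B.
  have -> : B + B = (2 : R[i]) *: B by rewrite scaler_nat mulr2n.
  by rewrite scalerA mulVf ?scale1r// pnatr_eq0.
have nhalf (B C : bop V V) (r : R) : nrm B <= r -> nrm C <= r ->
    nrm ((2^-1 : R[i]) *: (B + C)) <= r.
  move=> Br Cr; rewrite nrmZ nrmV.
  have -> : nrm (2 : R[i]) = 2.
    by rewrite -(rmorph_nat (real_complex R)) nrmC ger0_norm.
  by have := nrmD B C; rewrite mulrC ler_pdivrMr//; lra.
exists K, (K * nrm A * K + 1), M; split=> //.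
- by rewrite ltr_wpDl// !mulr_ge0 ?nrm_ge0// ltW.
- elim=> [|k IH] lam /=; first by rewrite expr1.
  have [P1 P2] := IH lam; have [Q1 Q2] := IH (w k * lam).
  have xE : ((w k * lam) *: A) ^+ (2 ^ k) = - (lam *: A) ^+ (2 ^ k).
    by rewrite -scalerA exprZ (wP k).1 scaleN1r.
  rewrite xE opprK in Q1 Q2.
  rewrite expnSr exprM; move: (_ ^+ (2 ^ k)) P1 P2 Q1 Q2 => x P1 P2 Q1 Q2.
  have xx1 : 1 - x ^+ 2 = (1 - x) * (1 + x).
    by rewrite mulrDr mulr1 mulrBl mul1r addrA subrK expr2.
  have xx2 : 1 - x ^+ 2 = (1 + x) * (1 - x).
    by rewrite mulrBr mulr1 mulrDl mul1r opprD addrA addrK expr2.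
  have s2 : 1 + x + (1 - x) = 1 + 1 :> bop V V by rewrite addrACA subrr addr0.
  split.
    rewrite -bopZAl mulrDl {1}xx1 xx2 !mulrA P1 Q1 !mul1r s2 half//.
  rewrite -bopZAr mulrDr {1}xx2 xx1 -!mulrA P2 Q2 !mulr1 s2 half//.
- elim=> [|k IH] lam lr /=; first exact: fK.
  by apply: nhalf; apply: IH; rewrite ?wl.
- elim=> [|k IH] lam mu lr mr /=; first exact: fL.
  rewrite -scalerBr opprD addrACA; apply: nhalf; first exact: IH.
  apply: le_trans (IH _ _ _ _) _; rewrite ?wl//.
  by rewrite -mulrBr wl.
Qed.

Definition dyadic_null (t : R) : Prop := forall e : R, 0 < e ->
  exists N, forall k, (N <= k)%N -> nrm ((t%:C *: A) ^+ (2 ^ k)) < e.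

Lemma nrm_dyadic (t : R) k : 0 <= t ->
  nrm ((t%:C *: A) ^+ (2 ^ k)) = t ^+ (2 ^ k) * nrm (A ^+ (2 ^ k)).
Proof.
by move=> t0; rewrite exprZ nrmZ -rmorphXn/= nrmC ger0_norm// exprn_ge0.
Qed.

(** Continuation in t. If the powers at t tend to 0, then M k t tends to 1. The Lipschitz bound,
    uniform in k, keeps M k close to 1 at t + eta, which bounds the powers there by 1 from some k
    on; at t + eta / 2 they are smaller by a factor tending to 0. *)
Lemma dyadic_null_step (rho K L eta t : R) (M : nat -> R[i] -> bop V V) :
    0 < K -> 0 < L ->
    (forall k lam, inverse_of (1 - (lam *: A) ^+ (2 ^ k)) (M k lam)) ->
    (forall k lam, nrm lam <= rho -> nrm (M k lam) <= K) ->
    (forall k lam mu, nrm lam <= rho -> nrm mu <= rho ->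
      nrm (M k lam - M k mu) <= L * nrm (lam - mu)) ->
    0 < eta -> L * eta <= 4^-1 -> 0 <= t -> t + eta <= rho ->
  dyadic_null t -> dyadic_null (t + eta / 2).
Proof.
move=> K0 L0 MI MK ML eta0 Leta t0 trho Zt.
have nt s : 0 <= s -> s <= rho -> nrm (s%:C : R[i]) <= rho.
  by move=> s0 sr; rewrite nrmC ger0_norm.
have [|N NP] := Zt (4^-1 / K); first by rewrite divr_gt0// invr_gt0.
pose t' := t + eta; have t'0 : 0 < t' by rewrite ltr_wpDl.
have bounded k : (N <= k)%N -> nrm ((t'%:C *: A) ^+ (2 ^ k)) <= 1.
  move=> Nk; set Q := _ ^+ _.
  have [M1 M2] := MI k t%:C; have [M1' M2'] := MI k t'%:C; rewrite -/Q in M1' M2'.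
  have tr : t <= rho by rewrite (le_trans _ trho)// lerDl ltW.
  have h1 : nrm (M k t%:C - 1) <= 4^-1.
    have -> : M k t%:C - 1 = M k t%:C * (t%:C *: A) ^+ (2 ^ k).
      by rewrite -[in LHS]M1 mulrBr mulr1 opprB addrC subrK.
    apply: le_trans (nrm_comp _ _) _.
    have := NP k Nk; rewrite ltr_pdivlMr// => h.
    apply: le_trans (ltW h); rewrite mulrC ler_wpM2l ?nrm_ge0//.
    by rewrite MK// nt.
  have h2 : nrm (M k t'%:C - M k t%:C) <= 4^-1.
    apply: le_trans (ML _ _ _ (nt _ (ltW t'0) trho) (nt _ t0 tr)) _.
    by rewrite -rmorphB nrmC /t' addrC addKr gtr0_norm.
  have h3 : nrm (M k t'%:C - 1) <= 2^-1.
    by have := nrm_tri (M k t'%:C) (M k t%:C) 1; lra.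
  (* With |M - 1| at most 1/2 this gives |Q| <= (1 + |Q|) / 2, that is |Q| <= 1; one quarter comes
     from t, the other from the step eta. *)
  have QE : Q = (M k t'%:C - 1) * (1 - Q).
    by rewrite mulrBl M1' mul1r opprB addrC subrK.
  have : nrm Q <= 2^-1 * (1 + nrm Q).
    rewrite {1}QE (le_trans (nrm_comp _ _))//.
    apply: ler_pM; rewrite ?nrm_ge0//.
    by apply: le_trans (nrmB _ _) _; have := @nrm_one R V; lra.
  by lra.
move=> e e0; pose r := (t + eta / 2) / t'.
have r0 : 0 <= r by rewrite divr_ge0 ?addr_ge0// ltW// divr_gt0.
have r1 : r < 1 by rewrite ltr_pdivrMr// mul1r /t'; lra.
have [N' NP'] : exists N', forall k, (N' <= k)%N -> r ^+ (2 ^ k) < e.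
  have : r ^+ n @[n --> \oo] --> (0 : R) by apply: cvg_expr; rewrite ger0_norm.
  move=> /cvgrPdist_lt/(_ e e0)[N' _ NP']; exists N' => k Nk.
  have := NP' (2 ^ k)%N _; rewrite /= sub0r normrN ger0_norm ?exprn_ge0//; apply.
  by rewrite (leq_trans Nk)// ltnW// ltn_expl.
exists (maxn N N') => k; rewrite geq_max => /andP[Nk Nk'].
have t''0 : 0 <= t + eta / 2 by rewrite addr_ge0// divr_ge0// ltW.
have := bounded k Nk; rewrite !nrm_dyadic ?(ltW t'0)// => h.
have -> : t + eta / 2 = r * t' by rewrite /r divfK// gt_eqF.
rewrite exprMn -mulrA; apply: le_lt_trans (NP' k Nk').
by rewrite ler_piMr// exprn_ge0.
Qed.

Lemma dyadic_null_all (t : R) : 0 <= t -> dyadic_null t.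
Proof.
(* Steps of eta / 2 lead from 0 to t or just beyond. The last one starts no later than t and looks
   ahead by eta <= 1, so the radius t + 1 suffices. *)
move=> t0; have [K [L [M [K0 L0 MI MK ML]]]] := dyadic_resolvents (t + 1).
pose eta := Num.min 1 (4^-1 / L).
have eta0 : 0 < eta by rewrite lt_min ltr01 divr_gt0// invr_gt0.
have eta1 : eta <= 1 by rewrite ge_min lexx.
have Leta : L * eta <= 4^-1.
  by rewrite mulrC -ler_pdivlMr// ge_min lexx orbT.
have Z j : j%:R * (eta / 2) <= t + eta / 2 -> dyadic_null (j%:R * (eta / 2)).
  elim: j => [_ e e0|j IH jt].
    exists 0%N => k _; rewrite mul0r scale0r expr0n expn_eq0/= nrm0//.
  have jE : j.+1%:R * (eta / 2) = j%:R * (eta / 2) + eta / 2.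
    by rewrite -natr1 mulrDl mul1r.
  rewrite jE in jt *; have j0 : 0 <= j%:R * (eta / 2).
    by rewrite mulr_ge0// divr_ge0// ltW.
  apply: (dyadic_null_step K0 L0 MI MK ML eta0 Leta j0); first lra.
  by apply: IH; lra.
pose j := (Num.truncn (t / (eta / 2))).+1.
have e2 : 0 < eta / 2 by rewrite divr_gt0.
have jt : t <= j%:R * (eta / 2).
  by rewrite -ler_pdivrMr// ltW// truncnS_gt.
move=> e e0; have [|N NP] := Z j _ e e0.
  rewrite /j -natr1 mulrDl mul1r lerD2r -ler_pdivlMr//.
  by rewrite truncn_le divr_ge0// ltW.
exists N => k Nk; apply: le_lt_trans (NP k Nk).
rewrite !nrm_dyadic ?(le_trans t0)// ler_wpM2r ?nrm_ge0//.
by rewrite lerXn2r// nnegrE (le_trans t0).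
Qed.

End Quasinilpotent.

(** * Invertible operators up to finite rank *)

Section WeylOperators.
Context {R : realType} {X : completeNormedModType R[i]}.
Implicit Types A B F : bop X X.

(** These are the Fredholm operators of index zero. *)
Definition weyl A : Prop :=
  exists B F, [/\ A = B + F, invertible B & degenerate F].

Lemma weylM A A' : weyl A -> weyl A' -> weyl (A * A').
Proof.
move=> [B [F [-> iB dF]]] [B' [F' [-> iB' dF']]].
exists (B * B'), (B * F' + F * (B' + F')); split.
- by rewrite mulrDl mulrDr addrA.
- exact: invertibleM.
- by apply: degenerateD; [exact: degenerateMl|exact: degenerateMr].
Qed.

Lemma invertible_weyl A : invertible A -> weyl A.
Proof. by move=> iA; exists A, 0; split; rewrite ?addr0//; exact: degenerate0. Qed.

(** A^n and B^n differ by a degenerate operator, so they agree on some nonzero vector, which B^n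
    shrinks at most by the factor |C|^n, C being the inverse of B. But the powers of exponent 2^k of
    |C| A tend to 0. *)
Lemma quasinilpotent_not_weyl A : ~ finite_dim [set: X] ->
  (forall lam : R[i], lam != 0 -> invertible (spectral_shift A lam)) -> ~ weyl A.
Proof.
move=> infX Aspec [B [F [AE [C [CB BC]] dF]]].
have pow n : exists2 G, A ^+ n = B ^+ n + G & degenerate G.
  elim: n => [|n [G AG dG]].
    by exists 0; [rewrite !expr0 addr0|exact: degenerate0].
  exists (B * G + F * A ^+ n).
    by rewrite exprS {1}AE mulrDl AG mulrDr -exprS -AG addrA.
  by apply: degenerateD; [exact: degenerateMl|exact: degenerateMr].
have lower n x : nrm x <= nrm C ^+ n * nrm ((B ^+ n) x).
  elim: n x => [|n IH] x; first by rewrite !expr0 mul1r.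
  apply: le_trans (IH x) _; rewrite exprSr -mulrA ler_wpM2l ?exprn_ge0 ?nrm_ge0//.
  rewrite exprS bopME.
  have /(congr1 (fun G : bop X X => G ((B ^+ n) x))) := CB.
  rewrite -[bop_comp C B _]/(C (B _)) /= => h.
  by rewrite -{1}[(B ^+ n) x]h bop_le.
have [N NP] := dyadic_null_all (complete_seq_complete (X := X)) Aspec (nrm_ge0 C) ltr01.
have := NP N (leqnn N); rewrite nrm_dyadic ?nrm_ge0// ltNge => /negP; apply.
have [G AG dG] := pow (2 ^ N)%N.
have [x x0 Gx] := degenerate_kernel infX dG.
have := lower (2 ^ N)%N x; have -> : (B ^+ (2 ^ N)) x = (A ^+ (2 ^ N)) x.
  by rewrite AG bopDE Gx addr0.
move=> h; have := bop_le (A ^+ (2 ^ N)) x.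
move=> /(ler_wpM2l (exprn_ge0 (2 ^ N) (nrm_ge0 C)))/(le_trans h).
by rewrite mulrA -{1}[nrm x]mul1r ler_pM2r// nrm_gt0.
Qed.

End WeylOperators.

(** * Scaled finite rank perturbations *)

Section ScaledPerturbation.
Context {R : realType} {X : completeNormedModType R[i]}.
Implicit Types (T A F K : bop X X) (s : seq (dual X * X)).

Section InverseOnePlusFinite.
Context (n : nat) (f : 'I_n -> dual X) (c : 'I_n -> X) (t : R[i]).

(** Matrix calculus for operators built from the f i and c i: [op Q] is [comb] after Q after [Phi],
    and M, the matrix of [Phi] after [comb], governs products. *)
Let Phi (x : X) : 'rV[R[i]]_n := \row_i (f i x : R[i]).
Let comb (v : 'rV[R[i]]_n) : X := \sum_i v 0 i *: c i.
Let M : 'M[R[i]]_n := \matrix_(i, j) (f j (c i) : R[i]).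
Let op (Q : 'M[R[i]]_n) : bop X X :=
  \sum_i rank1 (\sum_j Q j i *: f j) (c i).

Let opE Q x : op Q x = comb (Phi x *m Q).
Proof.
rewrite /op bop_sumE; apply: eq_bigr => i _; rewrite rank1E; congr (_ *: _).
rewrite bop_sumE !mxE; apply: eq_bigr => j _; rewrite mxE mulrC.
by rewrite bopZE.
Qed.

Let Phi_comb v : Phi (comb v) = v *m M.
Proof.
apply/rowP => j; rewrite !mxE /comb linear_sum; apply: eq_bigr => i _.
by rewrite linearZ mxE.
Qed.

Let combD v w : comb (v + w) = comb v + comb w.
Proof.
by rewrite /comb -big_split; apply: eq_bigr => i _; rewrite mxE scalerDl.
Qed.

Let combZ (a : R[i]) v : comb (a *: v) = a *: comb v.
Proof.
by rewrite /comb scaler_sumr; apply: eq_bigr => i _; rewrite mxE scalerA.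
Qed.

(* The Woodbury identity [(1 + t K)^-1 = 1 - t K (1 + t M)^-1]. *)
Lemma invertible_one_plus_finite : (1%:M + t *: M) \in unitmx ->
  invertible (1 + t *: \sum_i rank1 (f i) (c i)).
Proof.
move=> uM; pose Q := invmx (1%:M + t *: M).
have KE : \sum_i rank1 (f i) (c i) = op 1%:M.
  rewrite /op; apply: eq_bigr => i _; congr rank1.
  rewrite (bigD1 i)//= mxE eqxx scale1r big1 ?addr0// => j ji.
  by rewrite mxE (negbTE ji) scale0r.
have mul P P' : op P * op P' = op (P' *m M *m P).
  by apply: bopP => x; rewrite bopME !opE Phi_comb !mulmxA.
have opD P P' : op P + op P' = op (P + P').
  by apply: bopP => x; rewrite bopDE !opE mulmxDr combD.
have opZ (a : R[i]) P : a *: op P = op (a *: P).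
  by apply: bopP => x; rewrite bopZE !opE -scalemxAr combZ.
have key P P' : P + t *: P' = 1%:M ->
    t *: op 1%:M - t *: op P - t *: (t *: op P') = 0.
  by move=> <-; rewrite -!scalerBr opZ -opD [op P + _]addrC addrK subrr scaler0.
apply/invertibleP; exists (1 - t *: op Q); rewrite KE; split.
  rewrite mulrDr mulr1 mulrBl mul1r -addrA -[RHS]addr0; congr (1 + _).
  rewrite -bopZAl -!bopZAr mul mul1mx addrC addrAC.
  by rewrite key// scalemxAl -{1}[Q]mul1mx -mulmxDl mulmxV.
rewrite mulrDl mul1r mulrBr mulr1 -addrA -[RHS]addr0; congr (1 + _).
rewrite -bopZAl -!bopZAr mul mulmx1 addrA addrAC [- _ + _]addrC.
rewrite addrC [- _ - _]addrC addrA.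
by rewrite key// scalemxAr -{1}[Q]mulmx1 -mulmxDr mulVmx.
Qed.

Lemma invertible_one_plus_eigen : t != 0 ->
  ~~ root (char_poly M) (- t^-1) ->
  invertible (1 + t *: \sum_i rank1 (f i) (c i)).
Proof.
move=> t0 nroot; apply: invertible_one_plus_finite.
rewrite -row_free_unit -kermx_eq0; apply: contraNT nroot => /rowV0Pn[v vk v0].
rewrite -eigenvalue_root_char; apply/eigenvalueP; exists v => //.
move/sub_kermxP: vk; rewrite mulmxDr mulmx1 -scalemxAr => /eqP.
rewrite addrC addr_eq0 => /eqP vM.
by rewrite scaleNr -scalerN -vM scalerA mulVf// scale1r.
Qed.

End InverseOnePlusFinite.

(** After factoring out A, a bad t makes -1/t a root of a characteristic polynomial of degree
    [size s], too few roots for [size s] + 1 values. That n precedes A matters: the regular point at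
    which it is applied is chosen after n. *)
Lemma invertible_scaled_perturbation K : degenerate K ->
  exists n, forall A (t : nat -> R[i]), invertible A -> injective t ->
    (forall j, t j != 0) ->
    exists2 j, (j < n)%N & invertible (A + t j *: K).
Proof.
move=> [s ->]; exists (size s).+1 => A t iA tI t0; have [B [BA AB]] := iA.
pose f (i : 'I_(size s)) := (nth (0, 0) s i).1.
pose c (i : 'I_(size s)) := (nth (0, 0) s i).2.
have KE : rank1s s = \sum_i rank1 (f i) (c i).
  by rewrite /rank1s (big_nth (0, 0)) big_mkord.
pose M : 'M[R[i]]_(size s) := \matrix_(i, j) (f j (B (c i)) : R[i]).
pose rs := [seq - (t j)^-1 | j <- iota 0 (size s).+1].
have : ~~ all (root (char_poly M)) rs.
  apply/negP => h; have := max_poly_roots _ h _.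
  rewrite size_char_poly size_map size_iota ltnn => ctr.
  suff : false by []; apply: ctr; first exact/monic_neq0/char_poly_monic.
  rewrite map_inj_uniq ?iota_uniq// => j k /oppr_inj/invr_inj.
  exact: tI.
move=> /allPn[_ /mapP[j jn ->] nroot].
exists j; first by rewrite mem_iota in jn.
have -> : A + t j *: rank1s s = A * (1 + t j *: \sum_i rank1 (f i) (B (c i))).
  rewrite mulrDr mulr1 -bopZAr KE; congr (_ + _ *: _).
  rewrite mulr_sumr; apply: eq_bigr => i _; apply: bopP => x.
  rewrite bopME !rank1E linearZ/=; congr (_ *: _).
  by have /(congr1 (fun F : bop X X => F (c i))) := AB.
apply: invertibleM => //.
exact: invertible_one_plus_eigen.
Qed.

(** If every scaling tau / (j + 1) failed, the first n of them would fail on a common disc around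
    mu; a regular point of T in that disc contradicts the choice of n. *)
Lemma accessible_scaled_perturbation T K (mu : R[i]) (tau : R) :
    accessible T mu -> degenerate K -> 0 < tau ->
  exists t : R, [/\ 0 < t, t <= tau & accessible (T + t%:C *: K) mu].
Proof.
move=> acc dK tau0; pose t j : R := tau / j.+1%:R.
have t0 j : 0 < t j by rewrite divr_gt0.
apply: contrapT => h.
have far j : exists2 d : R, 0 < d & forall lam, nrm (lam - mu) < d ->
    ~ invertible (spectral_shift (T + (t j)%:C *: K) lam).
  apply: contrapT => hj; apply: h; exists (t j); split=> //.
    by rewrite ler_pdivrMr// ler_peMr ?ler1n// ltW.
  move=> d d0; apply: contrapT => hd; apply: hj; exists d => // lam ld il.
  by apply: hd; exists lam.
have [n nP] := invertible_scaled_perturbation dK.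
have {far}[d d0 dP] : exists2 d : R, 0 < d & forall j, (j < n)%N -> forall lam,
    nrm (lam - mu) < d -> ~ invertible (spectral_shift (T + (t j)%:C *: K) lam).
  elim: {nP}n => [|m [d d0 IH]]; first by exists 1.
  have [d' d'0 IH'] := far m; exists (Num.min d d'); first by rewrite lt_min d0.
  move=> j; rewrite ltnS leq_eqVlt => /predU1P[->|jm] lam.
    by rewrite lt_min => /andP[_]; exact: IH'.
  by rewrite lt_min => /andP[+ _]; exact: IH.
have [lam ld il] := acc d d0.
have [|j|j jn inv] := nP _ (fun j => (t j)%:C) il.
- move=> j k /complexI/(mulfI (lt0r_neq0 tau0))/invr_inj/eqP.
  by rewrite eqr_nat eqSS => /eqP.
- by rewrite eq_complex/= eqxx andbT gt_eqF.
apply: (dP j jn lam ld).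
rewrite (_ : spectral_shift _ _ = spectral_shift T lam + (t j)%:C *: K)//.
by rewrite /spectral_shift addrAC.
Qed.

End ScaledPerturbation.

(** * Perturbation at a boundary point of the spectrum *)

Section LocalDichotomy.
Context {R : realType} {X : completeNormedModType R[i]}.
Implicit Types (T F K : bop X X).

Definition small_degenerate_perturbation T (eps : R) : Prop :=
  exists F, [/\ degenerate F, nrm F < eps & has_invariant_half_space (T + F)].

Lemma degenerate_sum n (f : 'I_n -> dual X) (c : 'I_n -> X) :
  degenerate (\sum_i rank1 (f i) (c i)).
Proof.
apply: big_ind => [|A B|i _]; first exact: degenerate0.
  exact: degenerateD.
exact: degenerate_rank1.
Qed.

Lemma eigenspace_dichotomy T (mu : R[i]) : has_invariant_half_space T \/
  exists n (x : 'I_n -> X) (f : 'I_n -> dual X),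
    [/\ forall i, T (x i) = mu *: x i,
        forall i j, (f j (x i) : R[i]) = (i == j)%:R
      & forall a, T a = mu *: a -> a = \sum_i (f i a : R[i]) *: x i].
Proof.
have sY : Defs.subspace [set x | T x = mu *: x].
  split=> [|a x y /= Tx Ty]; first by rewrite /= linear0 scaler0.
  by rewrite linearP Tx Ty scalerDr !scalerA mulrC.
have [|||[x [f [xY xf]]]|[n [x [f [xY xf xE]]]]] :=
  @biorthogonal_dichotomy R[i] X (dual X) (fun a f => f a) _ _ _ sY.
- by move=> b a y t; exact: dual_linear.
- by [].
- by move=> a _; exact: dual_separates.
- by left; apply: (biorthogonal_eigenvectors_half_space xY xf).
- by right; exists n, x, f.
Qed.

Lemma coeigenspace_dichotomy T (mu : R[i]) : has_invariant_half_space T \/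
  exists m (g : 'I_m -> dual X) (c : 'I_m -> X),
    [/\ forall i, adjoint T (g i) = mu *: g i,
        forall i j, (g i (c j) : R[i]) = (i == j)%:R
      & forall h, adjoint T h = mu *: h -> h = \sum_i (h (c i) : R[i]) *: g i].
Proof.
have sY : Defs.subspace [set h : dual X | adjoint T h = mu *: h].
  split=> [|a x y]; first by rewrite /mkset linear0 scaler0.
  by rewrite /mkset => Tx Ty; rewrite linearP Tx Ty scalerDr !scalerA mulrC.
have [|||[x [f [xY xf]]]|[n [x [f [xY xf xE]]]]] :=
  @biorthogonal_dichotomy R[i] (dual X) X (fun h a => h a) _ _ _ sY.
- by [].
- by move=> b a y t; exact: dual_linear.
- move=> h _ h0; apply: contrapT => hn; case/eqP: h0; apply: bopP => x.
  by apply/eqP; rewrite -[_ == _]negbK; apply/negP => hx; apply: hn; exists x.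
- by left; apply: (biorthogonal_coeigenvectors_half_space xY xf).
- by right; exists n, x, f.
Qed.

Lemma rank1_sumE n (f : 'I_n -> dual X) (c : 'I_n -> X) x :
  (\sum_i rank1 (f i) (c i)) x = \sum_i (f i x : R[i]) *: c i.
Proof. by rewrite bop_sumE; apply: eq_bigr => i _; rewrite rank1E. Qed.

(** g j kills the range of T - mu, so applying it to the eigenvalue equation isolates t f j a. Once
    these vanish, a lies in the kernel of T - mu and all its coordinates are 0. *)
Lemma perturbed_kernel T (mu t : R[i]) n (f : 'I_n -> dual X) (c : 'I_n -> X)
    (g : 'I_n -> dual X) (x : 'I_n -> X) : t != 0 ->
    (forall i, adjoint T (g i) = mu *: g i) ->
    (forall i j, (g i (c j) : R[i]) = (i == j)%:R) ->
    (forall a, T a = mu *: a -> a = \sum_i (f i a : R[i]) *: x i) ->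
  forall a, (T + t *: \sum_i rank1 (f i) (c i)) a = mu *: a -> a = 0.
Proof.
move=> t0 gT gc xE a; rewrite bopDE bopZE rank1_sumE => Ta.
have fa j : (f j a : R[i]) = 0.
  have /(congr1 (fun y => g j y : R[i])) := Ta.
  rewrite linearD !linearZ/= linear_sum.
  have -> : g j (T a) = mu *: g j a.
    by have /(congr1 (fun h : dual X => h a)) := gT j.
  move/eqP; rewrite addrC -subr_eq0 addrK (bigD1 j)//= linearZ/= gc eqxx.
  rewrite big1 ?addr0 => [|i ij]; last first.
    by rewrite linearZ/= gc eq_sym (negbTE ij) scaler0.
  rewrite -[_ *: 1]/(_ * 1) mulr1 -[_ *: _]/(_ * _) mulf_eq0 (negbTE t0).
  by move/eqP.
have {}Ta : T a = mu *: a.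
  by rewrite -Ta big1 ?scaler0 ?addr0// => i _; rewrite fa scale0r.
by rewrite (xE a Ta) big1// => i _; rewrite fa scale0r.
Qed.

(** The dual computation: evaluating at x j isolates t h (c j). *)
Lemma perturbed_cokernel T (mu t : R[i]) n (f : 'I_n -> dual X) (c : 'I_n -> X)
    (g : 'I_n -> dual X) (x : 'I_n -> X) : t != 0 ->
    (forall i, T (x i) = mu *: x i) ->
    (forall i j, (f j (x i) : R[i]) = (i == j)%:R) ->
    (forall h, adjoint T h = mu *: h -> h = \sum_i (h (c i) : R[i]) *: g i) ->
  forall h, adjoint (T + t *: \sum_i rank1 (f i) (c i)) h = mu *: h -> h = 0.
Proof.
move=> t0 xT xf gE h Th.
have Ty y : h (T y) + t * \sum_i (f i y : R[i]) * h (c i) = mu * h y.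
  have /(congr1 (fun h : dual X => h y)) := Th.
  rewrite -[adjoint _ h y]/(h (_ y)) bopDE bopZE rank1_sumE linearD linearZ/=.
  rewrite linear_sum => e; apply: (etrans _ e); congr (_ + _).
  rewrite -[RHS]/(_ * _); congr (_ * _).
  by apply: eq_bigr => i _; rewrite linearZ.
have hc j : (h (c j) : R[i]) = 0.
  have := Ty (x j); rewrite xT linearZ/= => /eqP.
  rewrite addrC -subr_eq0 addrK (bigD1 j)//= xf eqxx mul1r.
  rewrite big1 ?addr0 => [|i ij]; last by rewrite xf eq_sym (negbTE ij) mul0r.
  by rewrite mulf_eq0 (negbTE t0) => /eqP.
have {}Th : adjoint T h = mu *: h.
  apply: bopP => y; rewrite bopZE -[RHS]/(mu * h y) -Ty big1 ?mulr0 ?addr0//.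
  by move=> i _; rewrite hc mulr0.
by rewrite (gE h Th) big1// => i _; rewrite hc scale0r.
Qed.

(* [K] maps the kernel of [T - mu] injectively into, or else onto, a complement of
   its range, so [T + t K - mu] or its adjoint is injective; for suitable small
   [t], [mu] stays a limit of regular points. *)
Lemma local_dichotomy T (mu : R[i]) (eps : R) : accessible T mu ->
    ~ invertible (spectral_shift T mu) -> 0 < eps ->
  small_degenerate_perturbation T eps \/
  [/\ weyl (spectral_shift T mu), exists2 x, x != 0 & T x = mu *: x
    & exists2 h, h != 0 & adjoint T h = mu *: h].
Proof.
move=> acc ninv eps0.
have hsT : has_invariant_half_space T -> small_degenerate_perturbation T eps.
  by exists 0; split; rewrite ?nrm0 ?addr0//; exact: degenerate0.
have [/hsT|[n [x [f [xT xf xE]]]]] := eigenspace_dichotomy T mu; first by left.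
have [/hsT|[m [g [c [gT gc gE]]]]] := coeigenspace_dichotomy T mu; first by left.
(* Half of eps goes to t K, the other half to the later rank one term. *)
have perturb K : degenerate K -> exists t : R,
    [/\ 0 < t, nrm (t%:C *: K) < eps / 2 & accessible (T + t%:C *: K) mu].
  move=> dK; have K1 : 0 < nrm K + 1 by rewrite ltr_wpDl ?nrm_ge0.
  have [|t [t0 tt acct]] := accessible_scaled_perturbation
    (tau := eps / 2 / (nrm K + 1)) acc dK.
    by rewrite !divr_gt0.
  exists t; split=> //; rewrite nrmZ nrmC gtr0_norm//.
  rewrite ler_pdivlMr// in tt; apply: lt_le_trans tt.
  by rewrite ltr_pM2l// ltrDl.
have conclude K (t : R) : degenerate K -> nrm (t%:C *: K) < eps / 2 ->
    (exists (f : dual X) c, [/\ f != 0, c != 0, nrm (rank1 f c) < eps / 2 &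
      has_invariant_half_space (T + t%:C *: K + rank1 f c)]) ->
    small_degenerate_perturbation T eps.
  move=> dK Ke [f' [c' [_ _ e' hs]]]; exists (t%:C *: K + rank1 f' c'); split.
  - by apply: degenerateD; [exact: degenerateZ|exact: degenerate_rank1].
  - by rewrite (le_lt_trans (nrmD _ _))//; lra.
  - by rewrite addrA.
have wey K (t : R) : degenerate K ->
    invertible (spectral_shift (T + t%:C *: K) mu) -> weyl (spectral_shift T mu).
  move=> dK iK; exists (spectral_shift (T + t%:C *: K) mu), (- t%:C *: K).
  split=> //; last exact: degenerateZ.
  by rewrite /spectral_shift scaleNr [T + _ - _]addrAC addrK.
have e2 : 0 < eps / 2 by rewrite divr_gt0.
have tC (t : R) : 0 < t -> t%:C != 0 :> R[i].
  by move=> t0; rewrite eq_complex/= eqxx andbT gt_eqF.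
have vecs : (0 < n)%N -> (0 < m)%N ->
    (exists2 x, x != 0 & T x = mu *: x) /\
    (exists2 h, h != 0 & adjoint T h = mu *: h).
  move=> n0 m0; split.
    exists (x (Ordinal n0)) => //; apply/eqP => x0.
    have := xf (Ordinal n0) (Ordinal n0); rewrite x0 linear0 eqxx => /eqP.
    by rewrite eq_sym oner_eq0.
  exists (g (Ordinal m0)) => //; apply/eqP => g0.
  have := gc (Ordinal m0) (Ordinal m0); rewrite g0 eqxx => /eqP.
  by rewrite eq_sym oner_eq0.
have [nm|mn] := leqP n m.
  pose w := widen_ord nm.
  pose K : bop X X := \sum_(i < n) rank1 (f i) (c (w i)).
  have dK : degenerate K by exact: degenerate_sum.
  have [t [t0 tK acct]] := perturb K dK.
  have [iK|niK] := pselect (invertible (spectral_shift (T + t%:C *: K) mu)).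
    (* If n were 0, K would vanish and mu would be regular for T; hence both kernels are nonzero. *)
    right; have n0 : (0 < n)%N.
      rewrite lt0n; apply/eqP => n0; apply: ninv; move: iK.
      rewrite (_ : K = 0) ?scaler0 ?addr0// /K.
      apply: big1 => -[i ilt] _; exfalso.
      by have : (i < 0)%N by rewrite -n0.
    have [] := vecs n0 (leq_trans n0 nm); split=> //; exact: wey iK.
  left; apply: (conclude K t) => //.
  apply: (rank_one_perturbation (mu := mu)) => //.
    by apply: accessible_blowup acct niK; exact: complete_seq_complete.
  apply: (perturbed_kernel (tC t t0) (g := fun i => g (w i))) xE => //.
pose w := widen_ord (ltnW mn).
pose K : bop X X := \sum_(i < m) rank1 (f (w i)) (c i).
have dK : degenerate K by exact: degenerate_sum.
have [t [t0 tK acct]] := perturb K dK.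
have [iK|niK] := pselect (invertible (spectral_shift (T + t%:C *: K) mu)).
  right; have m0 : (0 < m)%N.
    rewrite lt0n; apply/eqP => m0; apply: ninv; move: iK.
    rewrite (_ : K = 0) ?scaler0 ?addr0// /K.
    apply: big1 => -[i ilt] _; exfalso.
    by have : (i < 0)%N by rewrite -m0.
  have [] := vecs (leq_trans m0 (ltnW mn)) m0; split=> //; exact: wey iK.
left; apply: (conclude K t) => //.
apply: (corank_one_perturbation (mu := mu)) => //.
  exact: accessible_adjoint_blowup acct niK.
apply: (perturbed_cokernel (tC t t0) (x := fun i => x (w i))) gE => //.
Qed.

End LocalDichotomy.

(** * Structure of the spectrum *)

Section EigenvectorIndependence.
Context {K : fieldType} {V : lmodType K}.

Lemma eigenvectors_independent (S : {linear V -> V}) (x : nat -> V)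
    (nu : nat -> K) : injective nu -> (forall k, x k != 0) ->
  (forall k, S (x k) = nu k *: x k) -> independent x.
Proof.
move=> nuI x0 Sx; elim=> [|n IH] c cx; first by case.
have low (i : 'I_n) : c (widen_ord (leqnSn n) i) = 0.
  have dn (i' : 'I_n) : nu i' - nu n != 0.
    by rewrite subr_eq0 (inj_eq nuI) ltn_eqF.
  suff /eqP : c (widen_ord (leqnSn n) i) * (nu i - nu n) = 0.
    by rewrite mulf_eq0 (negbTE (dn i)) orbF => /eqP.
  apply: (IH (fun i => c (widen_ord (leqnSn n) i) * (nu i - nu n))) => {i}.
  have : S (lincomb (fun i : 'I_n.+1 => x i) c) -
      nu n *: lincomb (fun i : 'I_n.+1 => x i) c = 0.
    by rewrite cx linear0 scaler0 subr0.
  rewrite /lincomb linear_sum scaler_sumr -sumrB big_ord_recr/=.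
  rewrite linearZ/= Sx !scalerA [nu n * _]mulrC subrr addr0 => h.
  rewrite -[RHS]h; apply: eq_bigr => i _.
  by rewrite linearZ/= Sx !scalerA [nu n * _]mulrC -scalerBl mulrBr.
move=> i; have [ilt|] := ltnP i n.
  by rewrite -(low (Ordinal ilt)); congr c; apply: val_inj.
move=> ni; have -> : i = ord_max.
  by apply: val_inj; apply/eqP; rewrite eqn_leq ni -ltnS ltn_ord.
move: cx; rewrite /lincomb big_ord_recr/= big1 ?add0r.
  by move/eqP; rewrite scaler_eq0 (negbTE (x0 n)) orbF => /eqP.
by move=> j _; rewrite low scale0r.
Qed.

End EigenvectorIndependence.

Section SpectrumShape.
Context {R : realType} {X : completeNormedModType R[i]}.
Implicit Types T : bop X X.

Lemma eigenpairs_half_space T (nu : nat -> R[i]) : injective nu ->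
    (forall k, exists2 x, x != 0 & T x = nu k *: x) ->
    (forall k, exists2 h, h != 0 & adjoint T h = nu k *: h) ->
  has_invariant_half_space T.
Proof.
move=> nuI ex eh.
have [x xP] : exists x : nat -> X, forall k, x k != 0 /\ T (x k) = nu k *: x k.
  have [|x xP] := @choice _ _ (fun k x => x != 0 /\ T x = nu k *: x); last by exists x.
  by move=> k; have [x] := ex k; exists x.
have [h hP] : exists h : nat -> dual X, forall k,
    h k != 0 /\ adjoint T (h k) = nu k *: h k.
  have [|h hP] := @choice _ _ (fun k h => h != 0 /\ adjoint T h = nu k *: h);
    last by exists h.
  by move=> k; have [h] := eh k; exists h.
apply: (eigenvectors_half_space (x := x) (nu := nu) (f := h)).
- by move=> k; have [] := xP k.
(* Eigenvectors and coeigenvectors for different eigenvalues annihilate each other. *)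
- move=> j k jk; have : nu k * h j (x k) = nu j * h j (x k).
    have [_ /(congr1 (fun g : dual X => g (x k)))] := hP j.
    rewrite -[LHS]/(h j (T (x k))) (xP k).2 linearZ/=; exact.
  move/eqP; rewrite -subr_eq0 -mulrBl mulf_eq0 subr_eq0 (inj_eq nuI).
  by rewrite eq_sym (negbTE jk) => /eqP.
- apply: (eigenvectors_independent (S := T) (nu := fun k => nu k.*2)).
  + by move=> i j /nuI/double_inj.
  + by move=> k; have [] := xP k.*2.
  + by move=> k; have [] := xP k.*2.
- apply: (eigenvectors_independent (S := adjoint T) (nu := fun k => nu k.*2.+1)).
  + by move=> i j /nuI[/double_inj].
  + by move=> k; have [] := hP k.*2.+1.
  + by move=> k; have [] := hP k.*2.+1.
Qed.

(* Above each point [p + i s] of a small vertical segment there is a rightmost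
   spectral point, and these are all different. *)
Lemma finite_boundary_spectrum T (s : seq R[i]) :
    (forall mu, ~ invertible (spectral_shift T mu) -> accessible T mu -> mu \in s) ->
  forall mu, ~ invertible (spectral_shift T mu) -> accessible T mu.
Proof.
move=> bs [a b]; set p := (a +i* b)%C => np; apply: contrapT => nacc.
have cX := complete_seq_complete (X := X).
have [d d0 dP] : exists2 d : R, 0 < d & forall lam, nrm (lam - p) < d ->
    ~ invertible (spectral_shift T lam).
  apply: contrapT => h; apply: nacc => d d0; apply: contrapT => hd.
  by apply: h; exists d => // lam ld il; apply: hd; exists lam.
(* The denominators k + 2 keep the heights strictly below d already at k = 0. *)
have [q qP] : exists q : nat -> R[i], forall k,
    q k \in s /\ complex.Im (q k) = complex.Im p + d / k.+2%:R.
  have [|q qP] := @choice _ _ (fun k (z : R[i]) =>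
    z \in s /\ complex.Im z = complex.Im p + d / k.+2%:R); last by exists q.
  move=> k; pose z t : R[i] := ((complex.Re p + t) +i* (complex.Im p + d / k.+2%:R))%C.
  pose E := [set t : R | ~ invertible (spectral_shift T (z t))].
  have zz t t' : nrm (z t - z t') = `|t - t'|.
    rewrite -nrmC; congr nrm; apply/eqP; rewrite eq_complex/= subrr eqxx andbT.
    by apply/eqP; lra.
  have E0 : E 0.
    apply: dP; rewrite (_ : z 0 - p = 'i * (d / k.+2%:R)%:C); last first.
      rewrite /z /p /=; simpc.
      by rewrite addrAC subrr add0r.
    have -> : nrm ('i * (d / k.+2%:R)%:C : R[i]) = d / k.+2%:R.
      rewrite nrmM nrmC ger0_norm ?divr_ge0 ?ltW//.
      rewrite (_ : nrm 'i = 1) ?mul1r//.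
      by apply: complexI; rewrite nrmE normc_def/= expr0n add0r expr1n sqrtr1.
    by rewrite ltr_pdivrMr// ltr_pMr// ltr1n.
  have Eub : has_ubound E.
    exists (2 * nrm T + nrm (z 0)) => t Et; rewrite leNgt; apply/negP => tb.
    apply: Et; apply: regular_large => //.
    have := nrm_rev (z t - z 0) (- z 0); rewrite zz opprK subrK nrmN subr0.
    by have := ler_norm t; lra.
  have sE : has_sup E by split=> //; exists 0.
  (* The regular points form an open set, so the supremum is attained; the points to its right on
     the same line are regular, which makes it a boundary point. *)
  have nz : ~ invertible (spectral_shift T (z (sup E))).
    move=> /(regular_open cX)[e e0 eP].
    have [t Et te] := sup_adherent e0 sE.
    have tub := ub_le_sup Eub Et; apply: Et; apply: eP; rewrite zz ltr_norml.
    by apply/andP; split; lra.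
  exists (z (sup E)); split=> //; apply: bs => // e e0.
  exists (z (sup E + e / 2)).
    by rewrite zz addrC addKr gtr0_norm ?divr_gt0//; lra.
  apply: contrapT => h; have := ub_le_sup Eub h; lra.
have qI : injective q.
  move=> j k qjk; have [_ hj] := qP j; have [_ hk] := qP k.
  move: hj; rewrite qjk hk => /addrI/(mulfI (lt0r_neq0 d0))/invr_inj/eqP.
  by rewrite eqr_nat !eqSS => /eqP.
have un : uniq [seq q k | k <- iota 0 (size s).+1].
  by rewrite map_inj_uniq ?iota_uniq.
have := @uniq_leq_size _ _ s un; rewrite size_map size_iota ltnn.
suff sub : {subset [seq q k | k <- iota 0 (size s).+1] <= s} by move=> /(_ sub).
by move=> _ /mapP[k _ ->]; have [] := qP k.
Qed.

(** Evaluation at T, through which a factorisation into linear factors passes from polynomials to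
    operators. *)
Let ev T (p : {poly R[i]}) : bop X X := \sum_(i < size p) p`_i *: T ^+ i.

Let evE T (p : {poly R[i]}) n : (size p <= n)%N -> ev T p = \sum_(i < n) p`_i *: T ^+ i.
Proof.
move=> pn; rewrite /ev (big_ord_widen n (fun i => p`_i *: T ^+ i))//.
rewrite big_mkcond; apply: eq_bigr => i _; case: ltnP => // ip.
by rewrite nth_default// scale0r.
Qed.

Let evB T (p q : {poly R[i]}) : ev T (p - q) = ev T p - ev T q.
Proof.
pose n := maxn (size (p - q)) (maxn (size p) (size q)).
rewrite !(@evE T _ n) ?leq_max ?leqnn ?orbT//.
by rewrite -sumrB; apply: eq_bigr => i _; rewrite coefB scalerBl.
Qed.

Let evC T (a : R[i]) : ev T a%:P = a *: (1 : bop X X).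
Proof.
by rewrite (@evE T _ 1) ?size_polyC_leq1// big_ord1 coefC eqxx expr0.
Qed.

Let evZ T (a : R[i]) (p : {poly R[i]}) : ev T (a *: p) = a *: ev T p.
Proof.
rewrite (@evE T _ (size p)) ?size_scale_leq// /ev scaler_sumr.
by apply: eq_bigr => i _; rewrite coefZ scalerA.
Qed.

Let evMX T (p : {poly R[i]}) : ev T (p * 'X) = ev T p * T.
Proof.
rewrite (@evE T _ (size p).+1).
  rewrite big_ord_recl coefMX eqxx scale0r add0r /ev mulr_suml.
  by apply: eq_bigr => i _; rewrite coefMX /= exprSr bopZAl.
by rewrite (leq_trans (size_polyMleq _ _))// size_polyX addn2.
Qed.

Let ev_prod T (r : seq R[i]) :
  ev T (\prod_(mu <- r) ('X - mu%:P)) = \prod_(mu <- r) spectral_shift T mu.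
Proof.
elim/last_ind: r => [|r mu IH]; first by rewrite !big_nil evC scale1r.
rewrite -cats1 !big_cat/= !big_seq1 mulrBr evB evMX [_ * _%:P]mulrC.
by rewrite mul_polyC evZ IH /spectral_shift mulrBr -bopZAr mulr1.
Qed.

Lemma prod_invertible T (r : seq R[i]) :
  (forall mu, mu \in r -> invertible (spectral_shift T mu)) ->
  invertible (\prod_(mu <- r) spectral_shift T mu).
Proof.
elim: r => [|mu r IH] h; first by rewrite big_nil; exact: invertible1.
rewrite big_cons; apply: invertibleM; first by apply: h; rewrite mem_head.
by apply: IH => nu nr; apply: h; rewrite inE nr orbT.
Qed.

(** Spectral mapping: the roots of p - lam are regular points of T, since a spectral point lies in
    r, is a root of p, and lam is nonzero. A nonempty r makes p nonconstant, so p - lam is still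
    monic. *)
Lemma spectrum_prod T (r : seq R[i]) : (0 < size r)%N ->
    (forall mu, ~ invertible (spectral_shift T mu) -> mu \in r) ->
  forall lam, lam != 0 ->
    invertible (spectral_shift (\prod_(mu <- r) spectral_shift T mu) lam).
Proof.
move=> r0 spec lam l0; pose p := \prod_(mu <- r) ('X - mu%:P).
have sp : size p = (size r).+1 by rewrite size_prod_XsubC.
have [z zP] := closed_field_poly_normal (p - lam%:P).
have lc : lead_coef (p - lam%:P) = 1.
  rewrite lead_coefDl ?size_polyN; last first.
    by rewrite sp (leq_ltn_trans (size_polyC_leq1 _)).
  by apply/monicP; exact: monic_prod_XsubC.
rewrite lc scale1r in zP.
rewrite (_ : spectral_shift _ _ = \prod_(mu <- z) spectral_shift T mu).
  apply: prod_invertible => mu muz; apply: contrapT => /spec mur.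
  have : root (p - lam%:P) mu by rewrite zP root_prod_XsubC.
  rewrite rootE !hornerE (_ : p.[mu] = 0) ?sub0r ?oppr_eq0 ?(negbTE l0)//.
  by apply/eqP; rewrite -rootE root_prod_XsubC.
by rewrite -(ev_prod T z) -zP evB ev_prod evC.
Qed.

Lemma seq_or_injection (A : set R[i]) :
  (exists s : seq R[i], forall mu, A mu -> mu \in s) \/
  (exists2 nu : nat -> R[i], injective nu & forall k, A (nu k)).
Proof.
pose valid (s : seq R[i]) := uniq s /\ forall mu, mu \in s -> A mu.
have [ext|] := pselect (forall s, valid s -> exists mu, valid (rcons s mu)).
  right; have [//|nu nuP] := @seq_choice _ valid _ ext.
  exists nu => [j k jk|k]; last first.
    have [_] := nuP k.+1; apply; rewrite /mkseq map_f// mem_iota.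
    by rewrite add0n ltnSn.
  have [un _] := nuP (maxn j k).+1; apply/eqP.
  rewrite -(nth_uniq 0 _ _ un) ?size_mkseq ?ltnS ?leq_maxl ?leq_maxr//.
  by rewrite !nth_mkseq ?ltnS ?leq_maxl ?leq_maxr// jk.
move=> /existsNP[s /not_implyP[[us sA] next]]; left; exists s => mu Amu.
apply: contrapT => /negP mus; apply: next; exists mu; split.
  by rewrite rcons_uniq mus.
by move=> lam; rewrite mem_rcons inE => /predU1P[->|/sA].
Qed.

Theorem degenerate_perturbation T (eps : R) : ~ finite_dim [set: X] ->
  0 < eps -> small_degenerate_perturbation T eps.
Proof.
move=> infX eps0; apply: contrapT => none.
have loc mu : accessible T mu -> ~ invertible (spectral_shift T mu) ->
    [/\ weyl (spectral_shift T mu), exists2 x, x != 0 & T x = mu *: x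
      & exists2 h, h != 0 & adjoint T h = mu *: h].
  by move=> acc ni; have [] := local_dichotomy acc ni eps0.
have [[s bs]|[nu nuI nuP]] := seq_or_injection [set mu |
    ~ invertible (spectral_shift T mu) /\ accessible T mu]; last first.
  apply: none; exists 0; split; rewrite ?nrm0//; first exact: degenerate0.
  rewrite addr0; apply: (eigenpairs_half_space nuI) => k;
    by have [ni acc] := nuP k; have [] := loc _ acc ni.
have acc mu : ~ invertible (spectral_shift T mu) -> accessible T mu.
  by apply: finite_boundary_spectrum => lam ni al; exact: bs.
(* 0 is put in front so that the list is nonempty; the extra factor T is Weyl like all the
   others. *)
have spec mu : ~ invertible (spectral_shift T mu) -> mu \in 0 :: s.
  by move=> ni; rewrite inE bs ?orbT//; split=> //; exact: acc.
have := quasinilpotent_not_weyl infX (spectrum_prod (r := 0 :: s) isT spec).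
apply.
have wT mu : weyl (spectral_shift T mu).
  have [/invertible_weyl//|ni] := pselect (invertible (spectral_shift T mu)).
  by have [] := loc _ (acc _ ni) ni.
elim: (0 :: s) => [|mu r IH]; last by rewrite big_cons; exact: weylM.
by rewrite big_nil; exact/invertible_weyl/invertible1.
Qed.

End SpectrumShape.

Theorem theorem4p3 (R : realType) (X : completeNormedModType R[i])
    (infX : ~ finite_dim [set: X]) (T : bop X X) :
  (forall eps : R, 0 < eps ->
     exists F : bop X X,
       [/\ finite_rank F, `|F| < eps%:C & has_invariant_half_space (T + F)]) /\
  ((boundary (spectrum T) `\` point_spectrum T !=set0 \/
    boundary (spectrum (adjoint T)) `\` point_spectrum (adjoint T) !=set0) ->
   forall eps : R, 0 < eps ->
     exists F : bop X X,
       [/\ has_rank 1 F, `|F| < eps%:C & has_invariant_half_space (T + F)]).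
Proof.
split=> [eps eps0|h eps eps0].
  have [F [dF Fe hs]] := degenerate_perturbation T infX eps0.
  exists F; split=> //; first exact: degenerate_finite_rank.
  by rewrite -nrmE ltcR.
have [f [c [f0 c0 fe hs]]] : exists (f : dual X) (c : X),
    [/\ f != 0, c != 0, nrm (rank1 f c) < eps &
      has_invariant_half_space (T + rank1 f c)].
  have inj (V : normedModType R[i]) (S : bop V V) (mu : R[i]) :
      ~ point_spectrum S mu -> forall b, S b = mu *: b -> b = 0.
    move=> np b Sb; apply: contrapT => /eqP b0; apply: np.
    by exists b.
  case: h => -[mu [bmu npmu]].
    have cX := complete_seq_complete (X := X).
    have [ni acc] := (boundary_spectrumP cX T mu).1 bmu.
    apply: (rank_one_perturbation (mu := mu)) => //; last exact: inj.
    exact: accessible_blowup.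
  (* Now mu is a boundary point for the adjoint itself, so the blow-up comes from its own resolvents
     in the dual and not from transposed ones. *)
  have cX := dual_complete (X := X).
  have [ni acc] := (boundary_spectrumP cX (adjoint T) mu).1 bmu.
  apply: (corank_one_perturbation (mu := mu)) => //; last exact: inj.
  exact: accessible_blowup.
exists (rank1 f c); split=> //; first exact: rank1_has_rank.
by rewrite -nrmE ltcR.
Qed.
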